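(* Let $A\Rightarrow M$ be a Lie algebroid with anchor $\rho_A$, let $\mathfrak{k}\subset A$ be a partially split bundle of ideals, and fix $x\in M$. The symbol $l$ of any IM connection 1-form $(L,l)\in\Omega^1_{\mathrm{IM}}(A;\mathfrak{k})$ gives a decomposition of the isotropy Lie algebra $\mathfrak{g}_x:=\ker\rho_A|_x$ into a direct sum of ideals: $$\mathfrak{g}_x=(\mathfrak{g}_x\cap\ker l)\oplus\mathfrak{k}_x.$$
   Context: A bundle of ideals in a Lie algebroid $A\Rightarrow M$ (bracket $[\cdot,\cdot]$, anchor $\rho=\rho_A$) is a vector subbundle $\mathfrak{k}\subset\ker\rho$ with $[\alpha,\gamma]\in\Gamma(\mathfrak{k})$ for all $\alpha\in\Gamma(A)$, $\gamma\in\Gamma(\mathfrak{k})$. An IM connection 1-form for $\mathfrak{k}$ is a pair $(L,l)$ of a linear map $L:\Gamma(A)\to\Omega^1(M,\mathfrak{k})$ and a bundle map $l:A\to\mathfrak{k}$ (the symbol) with $l|_{\mathfrak{k}}=\mathrm{id}$, $L(f\alpha)=fL(\alpha)+df\otimes l(\alpha)$ and $$L([\alpha,\beta])=\mathcal{L}_\alpha L(\beta)-\mathcal{L}_\beta L(\alpha),\qquad l([\alpha,\beta])=[\alpha,l(\beta)]-i_{\rho(\beta)}L(\alpha),$$ where $(\mathcal{L}_\alpha\gamma)(X)=[\alpha,\gamma(X)]-\gamma([\rho(\alpha),X])$ for $\gamma\in\Omega^1(M,\mathfrak{k})$. $\mathfrak{k}$ is partially split if it admits an IM connection 1-form (equivalently,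 if there is a VB subalgebroid $E\Rightarrow TM$ of the tangent algebroid $TA\Rightarrow TM$ complementary to the image of $A\times_M\mathfrak{k}\hookrightarrow TA$, $(a,\gamma)\mapsto\frac{d}{d\tau}|_{0}(a+\tau\gamma)$). *)

(* Defs.v *)
From HB Require Import structures.
From mathcomp Require Import all_boot all_order all_algebra.
From mathcomp Require Import lra.
From mathcomp Require Import all_classical all_reals all_analysis.

Set Implicit Arguments.
Unset Strict Implicit.
Unset Printing Implicit Defensive.

Import Order.TTheory GRing.Theory Num.Theory.
Import numFieldNormedType.Exports.

Local Open Scope classical_set_scope.
Local Open Scope ring_scope.

Section EuclideanSmooth.
Variables (R : realType) (n : nat).
Implicit Types (U : set 'rV[R]_n) (f g : 'rV[R]_n -> R).

(* Differentiable j times at every point of U (meaningful for U open). *)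
Fixpoint ndifferentiable_on (j : nat) U f : Prop :=
  if j is j'.+1 then
    (forall y, U y -> differentiable f y)
    /\ (forall v, ndifferentiable_on j' U ('D_v f))
  else True.

Definition smooth_on U f := forall j, ndifferentiable_on j U f.

Lemma near_eq_differentiable f g y :
  {near y, f =1 g} -> differentiable f y -> differentiable g y.
Proof.
move=> fg df.
have fgy : f y = g y by exact: nbhs_singleton fg.
have gE : g \o shift y = cst (g y) + 'd f y +o_ (0 : 'rV[R]_n) id.
  apply/eqaddoP => e e0.
  have [_ /eqaddoP/(_ e e0) fE] := (diff_locallyP y f).1 df.
  have fg0 : \forall h \near (0 : 'rV[R]_n), f (h + y) = g (h + y).
    by move: fg; rewrite (near_shift 0 y) subr0.
  near=> h.
  have -> : (g \o shift y - (cst (g y) + 'd f y)) h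
          = (f \o shift y - (cst (f y) + 'd f y)) h.
    rewrite /= /GRing.add /= /GRing.opp /= fgy; congr (_ - _).
    by apply/esym; near: h.
  by near: h.
have dgf : 'd g y = 'd f y :> (_ -> _).
  by apply: diff_unique => //; exact: diff_continuous.
apply/diff_locallyP; rewrite dgf; split => //; exact: diff_continuous.
Unshelve. all: by end_near. Qed.

Lemma eq_ndifferentiable_on j U f g : open U -> (forall y, U y -> f y = g y) ->
  ndifferentiable_on j U f -> ndifferentiable_on j U g.
Proof.
move=> oU; elim: j f g => //= j IH f g fg [df Df].
have fgn y : U y -> {near y, f =1 g}.
  by move=> Uy; have := open_nbhs_nbhs (conj oU Uy); apply: filterS.
split=> [y Uy|v]; first exact: near_eq_differentiable (fgn y Uy) (df y Uy).
apply: (IH _ _ _ (Df v)) => y Uy; apply: near_eq_derive; exact: fgn.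
Qed.

Lemma ndifferentiable_onS j U f :
  ndifferentiable_on j.+1 U f -> ndifferentiable_on j U f.
Proof. by elim: j f => // j IH f [df Df]; split => // v; exact: IH. Qed.

Lemma smooth_on_cst U (c : R) : open U -> smooth_on U (cst c).
Proof.
move=> oU j; elim: j c => //= j IH c; split=> [y _|v].
  exact: differentiable_cst.
apply: (eq_ndifferentiable_on oU _ (IH 0)) => y _.
by rewrite derive_cst.
Qed.

Lemma ndifferentiable_onD j U f g : open U ->
  ndifferentiable_on j U f -> ndifferentiable_on j U g ->
  ndifferentiable_on j U (f \+ g).
Proof.
move=> oU; elim: j f g => //= j IH f g [df Df] [dg Dg]; split=> [y Uy|v].
  by apply: differentiableD; [exact: df|exact: dg].
apply: (eq_ndifferentiable_on oU _ (IH _ _ (Df v) (Dg v))) => y Uy /=.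
by rewrite -deriveD //; apply: diff_derivable; [exact: df|exact: dg].
Qed.

Lemma ndifferentiable_onM j U f g : open U ->
  ndifferentiable_on j U f -> ndifferentiable_on j U g ->
  ndifferentiable_on j U (f \* g).
Proof.
move=> oU; elim: j f g => // j IH f g Hf Hg.
have [df Df] := Hf; have [dg Dg] := Hg; split=> [y Uy|v].
  by apply: differentiableM; [exact: df|exact: dg].
have H1 := IH _ _ (ndifferentiable_onS Hf) (Dg v).
have H2 := IH _ _ (ndifferentiable_onS Hg) (Df v).
apply: (eq_ndifferentiable_on oU _ (ndifferentiable_onD oU H1 H2)) => y Uy /=.
by rewrite deriveM //; apply: diff_derivable; [exact: df|exact: dg].
Qed.

End EuclideanSmooth.


Section Manifolds.
Variables (R : realType) (n : nat).

Record chart (M : topologicalType) := Chart {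
  dom : set M;
  cod : set 'rV[R]_n;
  to_coord : M -> 'rV[R]_n;
  of_coord : 'rV[R]_n -> M;
  dom_open : open dom;
  cod_open : open cod;
  to_cod : forall p, dom p -> cod (to_coord p);
  of_dom : forall y, cod y -> dom (of_coord y);
  to_coordK : forall p, dom p -> of_coord (to_coord p) = p;
  of_coordK : forall y, cod y -> to_coord (of_coord y) = y;
  to_coord_continuous : forall p, dom p -> {for p, continuous to_coord};
  of_coord_continuous : forall y, cod y -> {for y, continuous of_coord} }.

Record manifold := Manifold {
  points :> topologicalType;
  atlas : set (chart points);
  atlas_cover : forall p, exists2 c, atlas c & dom c p;
  atlas_smooth : forall c d, atlas c -> atlas d -> forall i,
    smooth_on (cod c `&` of_coord c @^-1` dom d)
              (fun y => to_coord d (of_coord c y) ord0 i);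
  points_hausdorff : hausdorff_space points;
  points_second_countable : @second_countable points }.

End Manifolds.

Section SmoothFunctions.
Variables (R : realType) (n : nat) (M : manifold R n).

Definition msmooth_on (U : set M) (f : M -> R) :=
  forall c, atlas c -> smooth_on (cod c `&` of_coord c @^-1` U) (f \o of_coord c).

Lemma coord_open (c : chart R n M) (U : set M) :
  open U -> open (cod c `&` of_coord c @^-1` U).
Proof.
move=> oU; rewrite openE => y [cy Uy]; apply: filterI.
  by apply: open_nbhs_nbhs; split => //; exact: cod_open.
by apply: (of_coord_continuous cy); apply: open_nbhs_nbhs.
Qed.

Lemma msmooth_on_cst U (a : R) : open U -> msmooth_on U (cst a).
Proof. by move=> oU c _; apply: smooth_on_cst; exact: coord_open. Qed.

Lemma msmooth_onD U f g : open U ->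
  msmooth_on U f -> msmooth_on U g -> msmooth_on U (f \+ g).
Proof.
by move=> oU sf sg c ac j; apply: ndifferentiable_onD;
  [exact: coord_open|exact: sf|exact: sg].
Qed.

Lemma msmooth_onM U f g : open U ->
  msmooth_on U f -> msmooth_on U g -> msmooth_on U (f \* g).
Proof.
by move=> oU sf sg c ac j; apply: ndifferentiable_onM;
  [exact: coord_open|exact: sf|exact: sg].
Qed.

Lemma msmooth_on_sub U V f : open V -> V `<=` U ->
  msmooth_on U f -> msmooth_on V f.
Proof.
move=> oV VU sf c ac j; move: (sf c ac j).
have := @coord_open c V oV; set W := _ `&` _ => oW.
have WU : W `<=` cod c `&` of_coord c @^-1` U by move=> y [cy /VU].
elim: j (f \o _) => //= j IH g [dg Dg]; split=> [y /WU|v]; first exact: dg.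
exact: IH.
Qed.

Definition smooth_fun : {pred M -> R} := fun f => `[< msmooth_on setT f >].

Fact smooth_fun_subring : subring_closed smooth_fun.
Proof.
have sM (f g : M -> R) : f \in smooth_fun -> g \in smooth_fun ->
    f * g \in smooth_fun.
  by move=> /asboolP sf /asboolP sg; apply/asboolP; apply: msmooth_onM;
    first exact: openT.
have s1 (a : R) : (cst a : M -> R) \in smooth_fun.
  by apply/asboolP; apply: msmooth_on_cst; exact: openT.
split=> [|f g sf sg|]; [exact: s1| |exact: sM].
have -> : f - g = f + cst (-1) * g.
  by apply/funext => p; rewrite /= !fctE mulN1r.
have /asboolP sg' := sM _ _ (s1 (-1)) sg.
apply/asboolP; apply: msmooth_onD => //; [exact: openT|exact/asboolP].
Qed.

Fact smooth_fun_scaler : GRing.scaler_closed smooth_fun.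
Proof.
move=> a f sf; have -> : a *: f = cst a * f by [].
apply: (GRing.smulr_closedM (GRing.subring_closedM smooth_fun_subring)).2 => //.
by apply/asboolP; apply: msmooth_on_cst; exact: openT.
Qed.

HB.instance Definition _ :=
  GRing.isSubringClosed.Build (M -> R) smooth_fun smooth_fun_subring.
HB.instance Definition _ :=
  GRing.isScaleClosed.Build R (M -> R) smooth_fun smooth_fun_scaler.

End SmoothFunctions.
Arguments smooth_fun {R n} M _.

Record cinfty (R : realType) (n : nat) (M : manifold R n) :=
  CInfty { cinfty_fun :> M -> R; _ : cinfty_fun \in smooth_fun M }.

Section SmoothFunctionAlgebra.
Variables (R : realType) (n : nat) (M : manifold R n).

HB.instance Definition _ := [isSub for (@cinfty_fun R n M)].
HB.instance Definition _ := [Choice of cinfty M by <:].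
HB.instance Definition _ := GRing.SubChoice_isSubComPzRing.Build
  (M -> R) (smooth_fun M) (cinfty M) (@smooth_fun_subring R n M).
HB.instance Definition _ := [SubZmodule_isSubLmodule of cinfty M by <:].

Lemma cinftyP (f : cinfty M) : msmooth_on setT f.
Proof. by have /asboolP := valP f. Qed.

(* T_p M, as derivations of C^oo(M) at p. *)
Definition derivation_at (p : M) : {pred cinfty M -> R} := fun D =>
  `[< (forall (c : R) (f g : cinfty M), D (c *: f + g) = c * D f + D g)
      /\ (forall f g : cinfty M, D (f * g) = D f * g p + f p * D g) >].

Fact derivation_at_submod p : submod_closed (derivation_at p).
Proof.
split=> [|c D E /asboolP[Dl DM] /asboolP[El EM]]; apply/asboolP.
  have z h : (0 : cinfty M -> R) h = 0 by [].
  by split=> *; rewrite !z !(mulr0, mul0r) addr0.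
have e h : (c *: D + E : cinfty M -> R) h = c * D h + E h by [].
split=> [a f g|f g]; rewrite !e ?Dl ?El ?DM ?EM.
  by rewrite !mulrDr [c * (a * _)]mulrCA addrACA.
by rewrite !mulrDr !mulrDl addrACA !mulrA [c * f p]mulrC.
Qed.

HB.instance Definition _ p := GRing.isSubmodClosed.Build R (cinfty M -> R)
  (derivation_at p) (derivation_at_submod p).

End SmoothFunctionAlgebra.

Record tangent (R : realType) (n : nat) (M : manifold R n) (p : M) :=
  Tangent { tangent_fun :> cinfty M -> R; _ : tangent_fun \in derivation_at p }.

Section VectorFields.
Variables (R : realType) (n : nat) (M : manifold R n).

HB.instance Definition _ (p : M) := [isSub for (@tangent_fun R n M p)].
HB.instance Definition _ (p : M) := [Choice of tangent p by <:].
HB.instance Definition _ (p : M) := [SubChoice_isSubLmodule of tangent p by <:].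

Definition to_cinfty (f : M -> R) (sf : msmooth_on setT f) : cinfty M :=
  CInfty (asboolT sf).

Definition cinfty_cst (c : R) : cinfty M :=
  to_cinfty (@msmooth_on_cst R n M setT c openT).

Record vector_field := VectorField {
  vector_at :> forall p : M, tangent p;
  vector_field_smooth :
    forall f : cinfty M, msmooth_on setT (fun p => vector_at p f) }.

Definition vf_app (X : vector_field) (f : cinfty M) : cinfty M :=
  to_cinfty (vector_field_smooth X f).

Implicit Types X Y : vector_field.

Lemma tangent_linear p (v : tangent p) (c : R) (f g : cinfty M) :
  v (c *: f + g) = c * v f + v g.
Proof. by have /asboolP[vl _] := valP v; exact: vl. Qed.

Lemma tangentM p (v : tangent p) (f g : cinfty M) :
  v (f * g) = v f * g p + f p * v g.
Proof. by have /asboolP[_ vM] := valP v; exact: vM. Qed.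

Lemma cinfty_eq (f g : cinfty M) : (forall p, f p = g p) -> f = g.
Proof. by move=> fg; apply: val_inj; apply/funext. Qed.

Lemma vf_app_linear X (c : R) (f g : cinfty M) :
  vf_app X (c *: f + g) = c *: vf_app X f + vf_app X g.
Proof. by apply: cinfty_eq => p; exact: tangent_linear. Qed.

Lemma vf_appM X (f g : cinfty M) :
  vf_app X (f * g) = vf_app X f * g + f * vf_app X g.
Proof. by apply: cinfty_eq => p; exact: tangentM. Qed.

Fact vf_bracket_derivation X Y p :
  (fun f => X p (vf_app Y f) - Y p (vf_app X f)) \in derivation_at p.
Proof.
apply/asboolP; split=> [c f g|f g].
  by rewrite !vf_app_linear !tangent_linear mulrBr opprD addrACA.
have tD (v : tangent p) (h k : cinfty M) : v (h + k) = v h + v k.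
  by rewrite -[h]scale1r tangent_linear mul1r scale1r.
rewrite !vf_appM !tD !tangentM /=.
set a := X p (vf_app Y f); set b := X p (vf_app Y g).
set a' := Y p (vf_app X f); set b' := Y p (vf_app X g).
rewrite mulrBl mulrBr !opprD !addrA.
move: (a * g p) (f p * b) (a' * g p) (f p * b') (Y p f * X p g) (X p f * Y p g).
by move=> u1 u2 u3 u4 u5 u6; lra.
Qed.

Fact vf_bracket_smooth X Y (f : cinfty M) :
  msmooth_on setT
    (fun p => Tangent (vf_bracket_derivation X Y p) f).
Proof. exact: cinftyP (vf_app X (vf_app Y f) - vf_app Y (vf_app X f)). Qed.

Definition vf_bracket X Y : vector_field :=
  VectorField (vf_bracket_smooth X Y).

End VectorFields.
Arguments cinfty_cst {R n} M c.

Section VectorBundles.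
Variables (R : realType) (n : nat) (M : manifold R n).

Record trivialization (E : M -> lmodType R) (r : nat) := Trivialization {
  base : set M;
  base_open : open base;
  fibre_coord : forall p, {linear E p -> 'rV[R]_r};
  of_fibre_coord : forall p, 'rV[R]_r -> E p;
  fibre_coordK : forall p, base p ->
    cancel (@fibre_coord p) (@of_fibre_coord p);
  of_fibre_coordK : forall p, base p ->
    cancel (@of_fibre_coord p) (@fibre_coord p) }.

Record vector_bundle (r : nat) := VectorBundle {
  fibre :> M -> lmodType R;
  trivializations : set (trivialization fibre r);
  trivializations_cover : forall p, exists2 t, trivializations t & base t p;
  transition_smooth : forall s t, trivializations s -> trivializations t ->
    forall (w : 'rV[R]_r) i,
      msmooth_on (base s `&` base t)
        (fun p => fibre_coord t p (of_fibre_coord s p w) ord0 i) }.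

Definition smooth_section_on (r : nat) (E : vector_bundle r) (U : set M)
    (s : forall p, E p) :=
  forall t, trivializations t -> forall i,
    msmooth_on (U `&` base t) (fun p => fibre_coord t p (s p) ord0 i).

End VectorBundles.

Record gsection (R : realType) (n : nat) (M : manifold R n) (r : nat)
    (E : vector_bundle M r) := GSection {
  section_at :> forall p, E p;
  gsection_smooth : smooth_section_on setT section_at }.

Section SectionModule.
Variables (R : realType) (n : nat) (M : manifold R n) (r : nat).
Variable E : vector_bundle M r.
Implicit Types (s t : gsection E) (f g : cinfty M).

HB.instance Definition _ := gen_eqMixin (gsection E).
HB.instance Definition _ := gen_choiceMixin (gsection E).

Lemma gsection_eq s t : (forall p, s p = t p) -> s = t.
Proof.
case: s t => [s ss] [t st] /= st'; have := functional_extensionality_dep st'.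
by move=> e; case: _ / e st {st'} => st; congr GSection; exact: Prop_irrelevance.
Qed.

Fact gsection_lin_smooth f s t :
  smooth_section_on setT (fun p => f p *: s p + t p).
Proof.
move=> u au i; have oU : open (setT `&` base u).
  by apply: openI; [exact: openT|exact: base_open].
have -> : (fun p => fibre_coord u p (f p *: s p + t p) ord0 i) =
    ((f : M -> R) \* (fun p => fibre_coord u p (s p) ord0 i))
    \+ (fun p => fibre_coord u p (t p) ord0 i).
  by apply/funext => p /=; rewrite linearP !mxE.
apply: msmooth_onD => //; last exact: gsection_smooth.
apply: msmooth_onM => //; last exact: gsection_smooth.
by apply: msmooth_on_sub (cinftyP f).
Qed.

Fact gsection0_smooth : smooth_section_on setT (fun p => 0 : E p).
Proof.
move=> u au i; have -> : (fun p => fibre_coord u p 0 ord0 i) = cst 0.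
  by apply/funext => p; rewrite linear0 mxE.
by apply: msmooth_on_cst; apply: openI; [exact: openT|exact: base_open].
Qed.

Fact gsectionD_smooth s t : smooth_section_on setT (fun p => s p + t p).
Proof.
have -> : (fun p => s p + t p) = (fun p => (1 : cinfty M) p *: s p + t p).
  by apply/functional_extensionality_dep => p; rewrite scale1r.
exact: gsection_lin_smooth.
Qed.

Fact gsectionZ_smooth f s : smooth_section_on setT (fun p => f p *: s p).
Proof.
have -> : (fun p => f p *: s p) = (fun p => f p *: s p + GSection gsection0_smooth p).
  by apply/functional_extensionality_dep => p; rewrite addr0.
exact: gsection_lin_smooth.
Qed.

Fact gsectionN_smooth s : smooth_section_on setT (fun p => - s p).
Proof.
have -> : (fun p => - s p) = (fun p => (-1 : cinfty M) p *: s p).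
  by apply/functional_extensionality_dep => p; rewrite scaleN1r.
exact: gsectionZ_smooth.
Qed.

Definition gsection_zero := GSection gsection0_smooth.
Definition gsection_add s t := GSection (gsectionD_smooth s t).
Definition gsection_opp s := GSection (gsectionN_smooth s).
Definition gsection_scale f s := GSection (gsectionZ_smooth f s).

Fact gsection_addA : associative gsection_add.
Proof. by move=> *; apply: gsection_eq => p; exact: addrA. Qed.
Fact gsection_addC : commutative gsection_add.
Proof. by move=> *; apply: gsection_eq => p; exact: addrC. Qed.
Fact gsection_add0 : left_id gsection_zero gsection_add.
Proof. by move=> *; apply: gsection_eq => p; exact: add0r. Qed.
Fact gsection_addN : left_inverse gsection_zero gsection_opp gsection_add.
Proof. by move=> *; apply: gsection_eq => p; exact: addNr. Qed.
HB.instance Definition _ := GRing.isZmodule.Build (gsection E)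
  gsection_addA gsection_addC gsection_add0 gsection_addN.

Fact gsection_scaleA f g s :
  gsection_scale f (gsection_scale g s) = gsection_scale (f * g) s.
Proof. by apply: gsection_eq => p; exact: scalerA. Qed.
Fact gsection_scale1 : left_id 1 gsection_scale.
Proof. by move=> s; apply: gsection_eq => p; exact: scale1r. Qed.
Fact gsection_scaleDr : right_distributive gsection_scale +%R.
Proof. by move=> f s t; apply: gsection_eq => p; exact: scalerDr. Qed.
Fact gsection_scaleDl s :
  {morph gsection_scale^~ s : f g / f + g >-> f + g}.
Proof. by move=> f g; apply: gsection_eq => p; exact: scalerDl. Qed.
HB.instance Definition _ := GRing.Zmodule_isLmodule.Build (cinfty M) (gsection E)
  gsection_scaleA gsection_scale1 gsection_scaleDr gsection_scaleDl.

End SectionModule.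

(* Smoothness of bundle maps and of forms is expressed through their action on
   smooth global sections; over a Hausdorff second countable base this is
   equivalent to smoothness in local trivializations. *)
Section LieAlgebroids.
Variables (R : realType) (n : nat) (M : manifold R n) (r : nat).

Record lie_algebroid := LieAlgebroid {
  algebroid_bundle :> vector_bundle M r;
  anchor : forall p, {linear algebroid_bundle p -> tangent p};
  anchor_smooth : forall (a : gsection algebroid_bundle) (f : cinfty M),
    msmooth_on setT (fun p => anchor p (a p) f);
  bracket : gsection algebroid_bundle -> gsection algebroid_bundle ->
    gsection algebroid_bundle;
  bracket_linear : forall (c : R) (a b d : gsection algebroid_bundle),
    bracket (cinfty_cst M c *: a + b) d = cinfty_cst M c *: bracket a d + bracket b d;
  bracket_alternating : forall a, bracket a a = 0;
  bracket_jacobi : forall a b d,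
    bracket a (bracket b d) + bracket b (bracket d a)
    + bracket d (bracket a b) = 0;
  bracket_leibniz : forall a (f : cinfty M) (b : gsection algebroid_bundle),
    bracket a (f *: b) = f *: bracket a b
      + vf_app (VectorField (anchor_smooth a)) f *: b }.

Variable A : lie_algebroid.

Definition anchor_vf (a : gsection A) : vector_field M :=
  VectorField (anchor_smooth a).

(* A rank m vector subbundle of A, given by its fibres and local frames, that is
   a bundle of ideals. *)
Record ideal_bundle (m : nat) := IdealBundle {
  ideal_at :> forall p : M, set (A p);
  ideal_frame : forall p, exists (U : set M) (e : 'I_m -> forall q, A q),
    [/\ open U, U p, forall i, smooth_section_on U (e i) &
      forall q, U q ->
        @ideal_at q = [set \sum_i c i *: e i q | c in [set: 'I_m -> R]]
        /\ forall c : 'I_m -> R, \sum_i c i *: e i q = 0 -> c = (fun=> 0)];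
  ideal_anchor : forall p (u : A p), ideal_at u -> anchor A p u = 0;
  ideal_bracket : forall a c : gsection A, (forall p, ideal_at (c p)) ->
    forall p, ideal_at (bracket a c p) }.

Arguments ideal_at {m} i p _.

Variables (m : nat) (k : ideal_bundle m).

(* Omega^1(M, k); Gamma(k) is the set of sections of A with values in k. *)
Record ideal_form := IdealForm {
  form_at :> forall p, {linear tangent p -> A p};
  form_ideal : forall p v, k p (form_at p v);
  form_smooth : forall X : vector_field M,
    smooth_section_on setT (fun p => form_at p (X p)) }.

Definition form_app (w : ideal_form) (X : vector_field M) : gsection A :=
  GSection (form_smooth w X).

(* (\mathcal L_a w)(X) *)
Definition form_lie (a : gsection A) (w : ideal_form) (X : vector_field M)
    : gsection A :=
  bracket a (form_app w X) - form_app w (vf_bracket (anchor_vf a) X).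

Record im_connection := IMConnection {
  im_op : gsection A -> ideal_form;
  symbol : forall p, {linear A p -> A p};
  symbol_ideal : forall p u, k p (symbol p u);
  symbol_smooth : forall a : gsection A,
    smooth_section_on setT (fun p => symbol p (a p));
  symbol_id : forall p u, k p u -> symbol p u = u;
  im_op_linear : forall (c : R) (a b : gsection A) p (v : tangent p),
    im_op (cinfty_cst M c *: a + b) p v = c *: im_op a p v + im_op b p v;
  im_op_leibniz : forall (f : cinfty M) (a : gsection A) p (v : tangent p),
    im_op (f *: a) p v = f p *: im_op a p v + v f *: symbol p (a p);
  im_op_bracket : forall a b X,
    form_app (im_op (bracket a b)) X
      = form_lie a (im_op b) X - form_lie b (im_op a) X;
  symbol_bracket : forall a b,
    GSection (symbol_smooth (bracket a b))
      = bracket a (GSection (symbol_smooth b))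
        - form_app (im_op a) (anchor_vf b) }.

Definition partially_split : Prop := inhabited im_connection.

Definition isotropy (x : M) : set (A x) := [set u | anchor A x u = 0].
Arguments isotropy x _ : clear implicits.

(* Bracket of the isotropy Lie algebra, computed with any two sections through
   u and v; when u and v lie in the isotropy the value does not depend on them,
   by the Leibniz rule. *)
Definition isotropy_bracket (x : M) (u v : A x) : A x :=
  xget 0 [set w | exists a b : gsection A,
    [/\ a x = u, b x = v & bracket a b x = w]].

Definition isotropy_ideal (x : M) (I : set (A x)) : Prop :=
  [/\ submod_closed (mem I), I `<=` isotropy x &
    forall u v, isotropy x u -> I v -> I (isotropy_bracket u v)].

Definition isotropy_direct_sum_of_ideals (x : M) (I J : set (A x)) : Prop :=
  [/\ isotropy_ideal I, isotropy_ideal J,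
    isotropy x = [set u + v | u in I & v in J] & I `&` J = [set 0]].

End LieAlgebroids.
Arguments isotropy {R n M r} A x _.
Arguments ideal_at {R n M r A m} i p _.

(* Main.v *)
Require Import Defs.
From mathcomp Require Import all_boot all_order all_algebra.
From mathcomp Require Import ring lra.
From mathcomp Require Import all_classical all_reals all_analysis.

(* The projection u |-> l(u) splits the isotropy algebra; that both summands are
   ideals follows from the IM equation l([a,b]) = [a, l(b)] - L(a)(rho(b)), once
   the value of [a,b] at x is known to depend on b only through b(x) whenever
   rho(a)(x) = 0.

   For a biadditive bracket the latter is the usual argument with cut-off frames
   and the Leibniz rule. The record lie_algebroid, however, makes the bracket
   linear in its first argument only and alternating, which algebraically does
   not give additivity in the second one. Additivity nevertheless follows from
   the Leibniz rule when dim M > 0. Along a coordinate line it amounts to: a map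
   L from pairs of smooth functions on the line to smooth functions, with
   L(hs, ht) = h L(s, t) for all smooth h, satisfies
   L(1, 1) = L(0, 1) + L(1, 0).
   - Near every point there are points p at which L is bounded from some C^k to
     C^2: otherwise a series of counterexamples, supported in small intervals
     accumulating at the given point, would be a smooth pair with a bad image.
   - Hence, near p, L(s, 1) depends only on the k-jet of s. Suppose it depends only
     on the m-jet, and let F(c) be its value at y0 for s + c (y - y0)^m. The
     image of (delta s + (y - y0)^(m+1), delta) has bounded second derivative
     uniformly in delta, and at y0 + delta h it is delta F((m+1) h) up to a small
     error; letting delta tend to 0, F is affine. Its slope is the limit of
     F(n)/n = L(s/n + (y - y0)^m, 1/n), that is L((y - y0)^m, 0), which vanishes
     for m > 0. So L(s, 1) depends only on the value of s, and the case m = 0 is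
     the claim.
   In dimension 0 points are open and [a,b](x) depends only on b(x) by locality. *)

Set Implicit Arguments.
Unset Strict Implicit.
Unset Printing Implicit Defensive.

Import Order.TTheory GRing.Theory Num.Theory.
Import numFieldNormedType.Exports.

Local Open Scope classical_set_scope.
Local Open Scope ring_scope.

(** * Smooth functions on the line *)

Section FlatFunctions.
Variable R : realType.
Implicit Types (p : {poly R}) (t s : R).

(** The polynomial factor makes the family closed under differentiation; [flat 1] is [expR (- t^-1)]
    extended by zero. *)
Definition flat p t : R := if 0 < t then p.[t^-1] * expR (- t^-1) else 0.

Lemma flat_le0 p t : t <= 0 -> flat p t = 0.
Proof. by rewrite /flat ltNge => ->. Qed.

(** A single term of the exponential series already gives [s ^+ i <= i! * expR s]. *)
Lemma exprn_expRN_bounded i : exists B, forall s, 0 <= s ->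
  s ^+ i * expR (- s) <= B.
Proof.
case: i => [|i].
  exists 1 => s s0; rewrite expr0 mul1r -expR0 ler_expR; lra.
exists (i.+1`!%:R) => s s0.
rewrite expRN ler_pdivrMr ?expR_gt0 // mulrC -ler_pdivrMr ?ltr0n ?fact_gt0 //.
by apply: le_trans (expR_ge1Dxn i s0); rewrite lerDr.
Qed.

Lemma horner_expRN_bounded p : exists B, forall s, 0 <= s ->
  `|p.[s] * expR (- s)| <= B.
Proof.
have [B BP] := choice exprn_expRN_bounded.
exists (\sum_(i < size p) `|p`_i| * B i) => s s0.
rewrite horner_coef mulr_suml (le_trans (ler_norm_sum _ _ _)) //.
apply: ler_sum => i _; rewrite -mulrA normrM ler_wpM2l //.
by rewrite ger0_norm ?BP // mulr_ge0 ?exprn_ge0 ?expR_ge0.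
Qed.

Lemma flat_bounded p : exists2 B, 0 < B & forall t, `|flat p t| <= B.
Proof.
have [B BP] := horner_expRN_bounded p.
exists (`|B| + 1) => [|t]; first by rewrite ltr_wpDl.
rewrite /flat; case: ifPn => [t0|_]; last by rewrite normr0 addr_ge0.
have := BP t^-1; rewrite invr_ge0 => /(_ (ltW t0)) /le_trans; apply.
by rewrite (le_trans (ler_norm B)) // lerDl.
Qed.

Lemma flatXM p t : flat p t = t * flat ('X * p) t.
Proof.
rewrite /flat; case: ifPn => [t0|_]; last by rewrite mulr0.
by rewrite hornerM hornerX !mulrA mulfV ?mul1r // gt_eqF.
Qed.

Lemma is_derive_flat p t : is_derive t 1 (flat p) (flat ('X^2 * (p - p^`())) t).
Proof.
have [t0|t0|->] := ltgtP t 0.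
- rewrite flat_le0 ?ltW //.
  apply: (@near_eq_is_derive _ _ _ (cst 0)). 
  near=> z; rewrite flat_le0 // ltW //; near: z; exact: lt_nbhsl.
- apply: (@near_eq_is_derive _ _ _ (fun t => p.[t^-1] * expR (- t^-1))).
    near=> z; rewrite /flat ifT //; near: z; exact: lt_nbhsr.
  rewrite /flat t0.
  have tn0 : t != 0 by rewrite gt_eqF.
  have dV : is_derive t 1 (fun y : R => y^-1) (- t ^- 2).
    apply: trigger_derive (is_deriveV _ _) _; first exact: tn0.
    by rewrite [X in X = _]mulr1.
  have dp := @is_derive1_comp R (horner p) _ t _ _ (is_derive_poly p t^-1) dV.
  have dNV := is_deriveN dV.
  have de := @is_derive1_comp R expR _ t _ _ (is_derive_expR _) dNV.
  apply: trigger_derive (is_deriveM dp de) _.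
  rewrite /GRing.scale /= !hornerE /=; field; lra.
- rewrite flat_le0 //.
  (* At 0 two factors [h] are split off, so the difference quotient is [h] times a bounded
     function. *)
  have [B B0 BP] := flat_bounded ('X * ('X * p)).
  have cvg0 : h^-1 *: (flat p (h *: 1 + 0) - flat p 0) @[h --> 0^'] --> (0 : R).
    apply/cvgrPdist_le => /= e e0; near=> h.
    have hn0 : h != 0 by near: h; exact: nbhs_dnbhs_neq.
    have heB : `|h| <= e / B by near: h; apply: dnbhs0_le; rewrite divr_gt0.
    rewrite sub0r normrN addr0 [h *: 1]mulr1 (flat_le0 p (lexx 0)) subr0.
    rewrite [X in h^-1 *: X]flatXM [X in _ * X]flatXM /GRing.scale /= mulKf //.
    rewrite normrM (le_trans (ler_wpM2r _ heB)) //.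
    by rewrite mulrAC ler_pdivrMr // ler_wpM2l // ltW.
  apply: DeriveDef; first by apply/cvg_ex; exists 0.
  exact: cvg_lim cvg0.
Unshelve. all: by end_near. Qed.

End FlatFunctions.

(** * Restriction and gluing of differentiable functions on Euclidean sets *)

Section EuclideanSmoothFunctions.
Variables (R : realType) (n : nat).
Implicit Types (U V : set 'rV[R]_n) (f g q : 'rV[R]_n -> R).

Lemma ndifferentiable_on_sub j U V f : V `<=` U ->
  ndifferentiable_on j U f -> ndifferentiable_on j V f.
Proof.
move=> VU; elim: j f => //= j IH f [df Df]; split=> [y /VU|v]; first exact: df.
exact: IH.
Qed.

Lemma ndifferentiable_onU j U V f :
  ndifferentiable_on j U f -> ndifferentiable_on j V f ->
  ndifferentiable_on j (U `|` V) f.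
Proof.
elim: j f => //= j IH f [Uf UDf] [Vf VDf]; split=> [y [Uy|Vy]|v].
- exact: Uf.
- exact: Vf.
- exact: IH.
Qed.

End EuclideanSmoothFunctions.

(** * Calculus on the line: smoothness, cut-offs, C^k bounds and rescaling *)

Section SmoothLine.
Variable R : realType.
Implicit Types (f g : R -> R) (y : R).

Fixpoint nderivable (j : nat) f : Prop :=
  if j is j'.+1 then (forall y, derivable f y 1) /\ nderivable j' (derive1 f)
  else True.

Definition smoothR f := forall j, nderivable j f.

Lemma smoothR_derivable f y : smoothR f -> derivable f y 1.
Proof. by move=> /(_ 1%N)[]. Qed.

Lemma smoothR_derive1 f : smoothR f -> smoothR (derive1 f).
Proof. by move=> sf j; have [] := sf j.+1. Qed.

Lemma smoothR_derive1n f n : smoothR f -> smoothR (derive1n n f).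
Proof. by elim: n => // n IH sf; rewrite derive1nS; exact/smoothR_derive1/IH. Qed.

Lemma smoothR_is_derive f n (y : R) : smoothR f ->
  is_derive y 1 (derive1n n f) (derive1n n.+1 f y).
Proof.
move=> sf; rewrite derive1nS derive1E; apply/derivableP.
exact/smoothR_derivable/smoothR_derive1n.
Qed.

Lemma smoothR_continuous f n : smoothR f -> continuous (derive1n n f).
Proof.
move=> sf y; apply/differentiable_continuous/derivable1_diffP.
exact/smoothR_derivable/smoothR_derive1n.
Qed.

Lemma derive1_ext f g : (forall y, is_derive y 1 f (g y)) -> derive1 f = g.
Proof. by move=> fg; apply/funext => y; rewrite derive1E; have [_ ->] := fg y. Qed.

(** A tower lists a function with all its derivatives; exhibiting one both computes them and proves
    smoothness. *)
Lemma derive1n_tower (F : nat -> R -> R) :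
  (forall n y, is_derive y 1 (F n) (F n.+1 y)) -> forall n, derive1n n (F 0%N) = F n.
Proof.
by move=> dF; elim=> // n IH; rewrite derive1nS IH; apply: derive1_ext.
Qed.

Lemma smoothR_tower (F : nat -> R -> R) :
  (forall n y, is_derive y 1 (F n) (F n.+1 y)) -> smoothR (F 0%N).
Proof.
move=> dF j; elim: j F dF => //= j IH F dF; split=> [y|]; first by case: (dF 0%N y).
by rewrite (derive1_ext (dF 0%N)); apply: (IH (fun n => F n.+1)).
Qed.

Lemma nderivableS j f : nderivable j.+1 f -> nderivable j f.
Proof. by elim: j f => // j IH f [df Df]; split => //; exact: IH. Qed.

Lemma smoothR_cst c : smoothR (cst c).
Proof.
move=> j; elim: j c => //= j IH c; split=> [y|]; first exact: derivable_cst.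
by rewrite (derive1_ext (g := cst 0)).
Qed.

Lemma derive1n_add f g n : smoothR f -> smoothR g ->
  derive1n n (f \+ g) = derive1n n f \+ derive1n n g.
Proof.
move=> sf sg; apply: (@derive1n_tower (fun n => derive1n n f \+ derive1n n g)).
by move=> m y; apply: is_deriveD; exact: smoothR_is_derive.
Qed.

Lemma smoothR_add f g : smoothR f -> smoothR g -> smoothR (f \+ g).
Proof.
move=> sf sg; apply: (@smoothR_tower (fun n => derive1n n f \+ derive1n n g)).
by move=> m y; apply: is_deriveD; exact: smoothR_is_derive.
Qed.

Lemma nderivable_add j f g : nderivable j f -> nderivable j g ->
  nderivable j (f \+ g).
Proof.
elim: j f g => //= j IH f g [df Df] [dg Dg]; split=> [y|]; first exact: derivableD.
have -> : derive1 (f \+ g) = derive1 f \+ derive1 g; last exact: IH.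
by apply: derive1_ext => y /=; rewrite !derive1E; apply: is_deriveD; exact/derivableP.
Qed.

Lemma nderivable_mul j f g : nderivable j f -> nderivable j g ->
  nderivable j (f \* g).
Proof.
elim: j f g => //= j IH f g [df Df] [dg Dg]; split=> [y|]; first exact: derivableM.
have -> : derive1 (f \* g) = (f \* derive1 g) \+ (g \* derive1 f).
  by apply: derive1_ext => y /=; rewrite !derive1E; apply: is_deriveM; exact/derivableP.
by apply: nderivable_add; apply: IH => //; apply: nderivableS; split.
Qed.

Lemma smoothR_mul f g : smoothR f -> smoothR g -> smoothR (f \* g).
Proof. by move=> sf sg j; apply: nderivable_mul. Qed.

Lemma smoothR_comp f g : smoothR f -> smoothR g -> smoothR (f \o g).
Proof.
move=> sf sg j; elim: j f sf => //= j IH f sf.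
have df y : derivable (f \o g) y 1.
  apply/derivable1_diffP/differentiable_comp;
    exact/derivable1_diffP/smoothR_derivable.
split=> //.
have -> : derive1 (f \o g) = (derive1 f \o g) \* derive1 g.
  by apply/funext => y; rewrite derive1_comp //; exact: smoothR_derivable.
by apply: nderivable_mul; [exact/IH/smoothR_derive1|exact/smoothR_derive1].
Qed.

(** The derivative of [g = 1 / f] is [- g ^+ 2 * f'], again expressed through [g], so induction on
    the order closes. *)
Lemma smoothR_inv f : smoothR f -> (forall y, f y != 0) ->
  smoothR (fun y => (f y)^-1).
Proof.
move=> sf f0; pose g y := (f y)^-1.
have dg y : is_derive y 1 g ((cst (-1) \* (g \* g) \* derive1 f) y).
  rewrite /= -derive1n1 mulN1r -expr2 /g exprVn.
  exact: is_deriveV (f0 y) (smoothR_is_derive 0 y sf).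
elim=> [//|j IH]; split=> [y|]; first by have [] := dg y.
rewrite (derive1_ext dg); apply: nderivable_mul; last exact: smoothR_derive1.
by apply: nderivable_mul; [exact: smoothR_cst|exact: nderivable_mul].
Qed.

Lemma smoothR_horner (p : {poly R}) : smoothR (horner p).
Proof.
move=> j; elim: j p => //= j IH p; split=> [y|]; first exact: derivable_horner.
by rewrite (derive1_ext (g := horner p^`()%R)).
Qed.

Lemma smoothR_flat (p : {poly R}) : smoothR (flat p).
Proof.
move=> j; elim: j p => //= j IH p; split=> [y|]; first by have [] := is_derive_flat p y.
by rewrite (derive1_ext (is_derive_flat p)).
Qed.

Definition smooth_step (y : R) := flat 1 y * (flat 1 y + flat 1 (1 - y))^-1.

Lemma flat1_ge0 y : 0 <= flat 1 y.
Proof. by rewrite /flat; case: ifP => // _; rewrite hornerC mul1r expR_ge0. Qed.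

Lemma flat1_gt0 y : 0 < y -> 0 < flat 1 y.
Proof. by move=> y0; rewrite /flat y0 hornerC mul1r expR_gt0. Qed.

Lemma smoothR_step : smoothR smooth_step.
Proof.
pose d y := flat 1 y + flat 1 (1 - y).
have d0 y : d y != 0.
  rewrite /d; case: (ltP 0 y) => y0.
    by rewrite gt_eqF // ltr_wpDr ?flat1_ge0 ?flat1_gt0.
  by rewrite gt_eqF // ltr_wpDl ?flat1_ge0 ?flat1_gt0 // subr_gt0 (le_lt_trans y0).
have sd : smoothR d.
  have -> : d = flat 1 \+ (flat 1 \o horner (1 - 'X)).
    by apply/funext => y; rewrite /d /= !hornerE.
  apply: smoothR_add; first exact: smoothR_flat.
  by apply: smoothR_comp; [exact: smoothR_flat|exact: smoothR_horner].
exact: smoothR_mul (smoothR_flat 1) (smoothR_inv sd d0).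
Qed.

Lemma smooth_step_le0 y : y <= 0 -> smooth_step y = 0.
Proof. by move=> y0; rewrite /smooth_step flat_le0 // mul0r. Qed.

Lemma smooth_step_ge1 y : 1 <= y -> smooth_step y = 1.
Proof.
move=> y1; rewrite /smooth_step (flat_le0 _ (t := 1 - y)); last lra.
rewrite addr0 mulfV // gt_eqF // flat1_gt0; lra.
Qed.

(** The argument of [smooth_step] is at most 0 for [r <= |y|] and at least 3/2 for [|y| <= r / 2];
    the square keeps it smooth at [y = 0]. *)
Definition plateau (r y : R) := smooth_step (2 * (1 - (y / r) ^+ 2)).

Lemma smoothR_plateau r : smoothR (plateau r).
Proof.
have -> : plateau r = smooth_step \o horner (2%:P * (1 - ('X * (r^-1)%:P) ^+ 2)).
  by apply/funext => y; rewrite /plateau /= !hornerE.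
exact: smoothR_comp smoothR_step (smoothR_horner _).
Qed.

Lemma plateau1 r y : 0 < r -> `|y| <= r / 2 -> plateau r y = 1.
Proof.
move=> r0 yr; apply: smooth_step_ge1.
have : (`|y| / r) ^+ 2 <= (1 / 2) ^+ 2.
  rewrite ler_sqr ?nnegrE //; last by rewrite divr_ge0 // ltW.
  by rewrite ler_pdivrMr // mulrC mul1r mulrC mulrC.
rewrite !expr_div_n real_normK ?num_real // -!expr_div_n; lra.
Qed.

Lemma plateau0 r y : 0 < r -> r <= `|y| -> plateau r y = 0.
Proof.
move=> r0 ry; apply: smooth_step_le0.
have : 1 ^+ 2 <= (`|y| / r) ^+ 2.
  rewrite ler_sqr ?nnegrE //; first by rewrite ler_pdivlMr // mul1r.
  by rewrite divr_ge0 // ltW.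
rewrite expr_div_n real_normK ?num_real // -expr_div_n; lra.
Qed.

Definition cbounded (k : nat) (B : R) f :=
  forall i y, (i <= k)%N -> `|derive1n i f y| <= B.

Definition supported (p r : R) f := forall y, r <= `|y - p| -> f y = 0.

(** The strict inequality leaves a neighbourhood of [y] on which [f] vanishes. *)
Lemma supported_derive1n p r f n y : supported p r f ->
  r < `|y - p| -> derive1n n f y = 0.
Proof.
move=> sf; elim: n y => [|n IH] y ry; first exact/sf/ltW.
rewrite derive1nS derive1E (near_eq_derive (g := cst 0)) ?derive_cst //.
have : \forall z \near y, r < `|z - p|.
  have c : continuous (fun z : R => `|z - p|).
    by move=> z; apply: cvg_norm; apply: cvgB; [exact: cvg_id|exact: cvg_cst].
  have := c y; move/cvgr_gt; exact.
by apply: filterS => z; exact: IH.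
Qed.

Lemma supported_cbounded k p r f : 0 < r -> smoothR f -> supported p r f ->
  exists2 B, 0 < B & cbounded k B f.
Proof.
move=> r0 sf pf.
have bd i : exists B, forall y, `|derive1n i f y| <= B.
  have cn : {within `[p - r, p + r], continuous (fun y => `|derive1n i f y|)}.
    apply: continuous_subspaceT => y; apply: cvg_norm.
    exact: smoothR_continuous.
  have [|c _ cP] := EVT_max _ cn; first lra.
  exists `|derive1n i f c| => y; case: (lerP `|y - p| r) => yr.
    by apply: cP; rewrite in_itv /= -ler_distl.
  by rewrite (supported_derive1n _ pf yr) normr0.
have [B BP] := choice bd.
exists (1 + \sum_(i < k.+1) `|B i|) => [|i y ik].
  by rewrite ltr_wpDr // sumr_ge0.
rewrite (le_trans (BP i y)) // (le_trans (ler_norm _)) //.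
by rewrite (bigD1 (Ordinal (ik : (i < k.+1)%N))) //= addrCA lerDl addr_ge0 // sumr_ge0.
Qed.

Lemma cboundedD k B C f g : smoothR f -> smoothR g ->
  cbounded k B f -> cbounded k C g -> cbounded k (B + C) (f \+ g).
Proof.
move=> sf sg bf bg i y ik; rewrite derive1n_add //=.
by rewrite (le_trans (ler_normD _ _)) // lerD ?bf ?bg.
Qed.

Lemma cboundedZ k B c f : smoothR f -> cbounded k B f ->
  cbounded k (`|c| * B) (cst c \* f).
Proof.
move=> sf bf i y ik.
have tw n (z : R) : is_derive z 1 (cst c \* derive1n n f) ((cst c \* derive1n n.+1 f) z).
  by have h := is_deriveZ c (smoothR_is_derive n z sf); exact h.
rewrite (@derive1n_tower (fun n => cst c \* derive1n n f)) //=.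
by rewrite normrM ler_wpM2l // bf.
Qed.

Lemma cboundedW k B C f : B <= C -> cbounded k B f -> cbounded k C f.
Proof. by move=> BC bf i y ik; exact: le_trans (bf i y ik) BC. Qed.

Definition rescale (c p r : R) f (y : R) := c * f ((y - p) / r).

Lemma rescale_tower c p r f : smoothR f -> forall n y,
  is_derive y 1 (rescale (c * r^-1 ^+ n) p r (derive1n n f))
    (rescale (c * r^-1 ^+ n.+1) p r (derive1n n.+1 f) y).
Proof.
move=> sf n y.
have da : is_derive y 1 (fun y => (y - p) / r) r^-1.
  have -> : (fun y => (y - p) / r) = horner (('X - p%:P) * (r^-1)%:P).
    by apply/funext => z; rewrite !hornerE.
  apply: trigger_derive (is_derive_poly _ _) _.
  by rewrite derivM derivB derivX !derivC subr0 mulr0 addr0 mul1r hornerC.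
have := @is_derive1_comp R (derive1n n f) _ y _ _ (smoothR_is_derive _ _ sf) da.
move/(is_deriveZ (c * r^-1 ^+ n)) => h.
have <- : (c * r^-1 ^+ n) *: (derive1n n.+1 f ((y - p) / r) / r)
    = rescale (c * r^-1 ^+ n.+1) p r (derive1n n.+1 f) y.
  by rewrite /rescale /GRing.scale /= exprSr; ring.
exact h.
Qed.

Lemma smoothR_rescale c p r f : smoothR f -> smoothR (rescale c p r f).
Proof.
move=> sf; have := @smoothR_tower _ (rescale_tower c p r sf).
by rewrite expr0 mulr1.
Qed.

(** The [i]-th derivative is multiplied by [c / r ^+ i]; as [r <= 1], the order [k] is the worst
    one. *)
Lemma cbounded_rescale k c p r f B A : smoothR f -> 0 < r -> r <= 1 ->
  cbounded k B f -> `|c| <= A * r ^+ k -> cbounded k (A * B) (rescale c p r f).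
Proof.
move=> sf r0 r1 bf cA i y ik.
have := @derive1n_tower _ (rescale_tower c p r sf) i; rewrite expr0 mulr1 => ->.
rewrite /rescale !normrM ler_pM ?mulr_ge0 //; last exact: bf.
rewrite normrX normrV ?unitfE ?gt_eqF // (gtr0_norm r0) exprVn.
rewrite ler_pdivrMr ?exprn_gt0 // (le_trans cA) //.
have A0 : 0 <= A by rewrite -(pmulr_lge0 _ (exprn_gt0 k r0)) (le_trans _ cA).
by rewrite ler_wpM2l // ler_wiXn2l // ltW.
Qed.

Lemma smoothR_sum (I : finType) (F : I -> R -> R) :
  (forall i, smoothR (F i)) -> smoothR (\sum_i F i).
Proof.
by move=> sF; apply: (big_ind smoothR) => // [|*]; [exact: smoothR_cst|exact: smoothR_add].
Qed.

Lemma cbounded_sum k (I : finType) (F : I -> R -> R) (B : I -> R) :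
  (forall i, smoothR (F i)) -> (forall i, cbounded k (B i) (F i)) ->
  cbounded k (\sum_i B i) (\sum_i F i).
Proof.
move=> sF bF; suff [] : smoothR (\sum_i F i) /\ cbounded k (\sum_i B i) (\sum_i F i) by [].
apply: (big_ind2 (fun f (b : R) => smoothR f /\ cbounded k b f)) => [|f b g c [sf bf] [sg bg]|i _].
- split=> [|i y _]; first exact: smoothR_cst.
  rewrite (@derive1n_tower (fun=> cst 0)) ?normr0 // => n z; exact: is_derive_cst.
- by split; [exact: smoothR_add|exact: cboundedD].
- by split.
Qed.

End SmoothLine.

Lemma smooth_on_comp (R : realType) (n : nat) (U : set 'rV[R]_n)
    (f : R -> R) (q : 'rV[R]_n -> R) : open U -> smoothR f -> smooth_on U q ->
  smooth_on U (f \o q).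
Proof.
move=> oU sf sq j; elim: j f sf => //= j IH f sf; have [dq _] := sq 1%N.
have df t : differentiable f t by exact/derivable1_diffP/smoothR_derivable.
split=> [y Uy|v]; first exact: differentiable_comp (dq y Uy) (df _).
have [_ Dq] := sq j.+1.
have H := ndifferentiable_onM oU (Dq v) (IH _ (smoothR_derive1 sf)).
apply: (eq_ndifferentiable_on oU _ H) => y Uy /=; have dqy := dq y Uy.
rewrite (deriveE v (differentiable_comp dqy (df _))) (diff_comp dqy (df _)) /=.
rewrite deriv1E; last exact: smoothR_derivable.
by rewrite -deriveE.
Qed.

(** * Homogeneous maps on pairs of smooth functions *)

Section FlatSeries.
Variable R : realType.
Implicit Types (f g : R -> R) (y : R).

Lemma is_derive_quadratic f (q d : R) : 0 < d ->
  (forall y, `|y - q| < d -> `|f y| <= (y - q) ^+ 2) -> is_derive q 1 f 0.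
Proof.
move=> d0 fq; have fq0 : f q = 0.
  apply/eqP; rewrite -normr_le0; have := fq q; rewrite subrr normr0 expr0n; exact.
have cvg0 : h^-1 *: (f (h *: 1 + q) - f q) @[h --> 0^'] --> (0 : R).
  apply/cvgrPdist_le => /= e e0; near=> h.
  have hn0 : h != 0 by near: h; exact: nbhs_dnbhs_neq.
  have he : `|h| <= e by near: h; exact: dnbhs0_le.
  have hd : `|h| < d by near: h; exact: dnbhs0_lt.
  rewrite sub0r normrN fq0 subr0 [h *: 1]mulr1 /GRing.scale /= normrM normfV.
  rewrite ler_pdivrMl ?normr_gt0 //.
  have := fq (h + q); rewrite addrK => /(_ hd) /le_trans; apply.
  by rewrite -real_normK ?num_real // expr2 ler_wpM2l.
apply: DeriveDef; first by apply/cvg_ex; exists 0.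
exact: cvg_lim cvg0.
Unshelve. all: by end_near. Qed.

Variables (q e : R).
Hypothesis e0 : 0 < e.

Let u (k : nat) : R := e / 2 ^+ k.

Let u0 k : 0 < u k. Proof. by rewrite divr_gt0 // exprn_gt0. Qed.

Let u_half j k : (j < k)%N -> u k <= u j / 2.
Proof.
move=> jk; rewrite /u -mulrA -invfM ler_pM2l // lef_pV2 ?posrE ?mulr_gt0 ?exprn_gt0 //.
by rewrite -exprSr ler_weXn2l // ler1n.
Qed.

Lemma geometric_small (d : R) : 0 < d ->
  exists N, forall k, (N <= k)%N -> e / 2 ^+ k < d.
Proof.
move=> d0; exists (Num.bound (e / d)) => k Nk.
rewrite ltr_pdivrMr ?exprn_gt0 // mulrC -ltr_pdivrMr //.
apply: lt_trans (archi_boundP (ltW (divr_gt0 e0 d0))) _.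
by rewrite -natrX ltr_nat (leq_ltn_trans Nk) // ltn_expl.
Qed.

(** The supports are disjoint intervals accumulating only at [q]. Away from [q] the sum is locally
    finite; at [q] the weights [(u k / 2) ^+ 2] and the C^k bounds make every termwise derivative
    quadratically small. *)
Lemma flat_series (S : nat -> R -> R) :
  (forall k, smoothR (S k)) ->
  (forall k, supported (q + u k) (u k / 4) (S k)) ->
  (forall k, cbounded k 1 (S k)) ->
  exists2 V, smoothR V & forall k y, `|y - (q + u k)| < u k / 4 ->
    V y = (u k / 2) ^+ 2 * S k y.
Proof.
move=> sS supS bS.
(* From the index [N y] on, all supports lie to the left of [y]. *)
have NP y : exists N, q < y -> forall k, (N <= k)%N -> u k < (y - q) / 2.
  have [qy|] := ltP q y; last by exists 0%N.
  by have [|N NP] := @geometric_small ((y - q) / 2); [lra|exists N].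
have {NP} [N NP] := choice NP.
pose s n y k := (u k / 2) ^+ 2 * derive1n n (S k) y.
(* The candidate for the [n]-th derivative, by termwise differentiation. *)
pose F n y := if y <= q then 0 else \sum_(0 <= k < N y) s n y k.
have s0 n y k : u k / 4 < `|y - (q + u k)| -> s n y k = 0.
  by move=> yk; rewrite /s (supported_derive1n _ (supS k) yk) mulr0.
have FE n m y : q < m -> m <= y -> F n y = \sum_(0 <= k < N m) s n y k.
  move=> qm my; have qy := lt_le_trans qm my; rewrite /F leNgt qy /=.
  have tail M K : (M <= K)%N -> (forall k, (M <= k)%N -> u k < (y - q) / 2) ->
      \sum_(0 <= k < K) s n y k = \sum_(0 <= k < M) s n y k.
    move=> MK Mu; rewrite (big_cat_nat (n := M)) //= [X in _ + X]big_nat_cond.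
    rewrite [X in _ + X]big1 ?addr0 // => k /andP[/andP[/Mu uk _] _]; apply: s0.
    by have := u0 k; rewrite lter_normr; lra.
  rewrite -(tail (N y) (maxn (N y) (N m))) ?leq_maxl //; last exact: NP.
  rewrite -(tail (N m) (maxn (N y) (N m))) ?leq_maxr // => k Nk.
  by apply: lt_le_trans (NP m qm k Nk) _; lra.
have Fone n y j : `|y - (q + u j)| <= u j / 4 -> F n y = s n y j.
  move=> yj; have qy : q < y by have := u0 j; move: yj; rewrite ler_norml; lra.
  have Nj : (j < N y)%N.
    rewrite ltnNge; apply/negP => Njy; have := NP y qy j Njy.
    by have := u0 j; move: yj; rewrite ler_norml; lra.
  rewrite /F leNgt qy /= big_mkord (bigD1 (Ordinal Nj)) //= big1 ?addr0 //.
  move=> i; rewrite -val_eqE /= => ij; apply: s0; rewrite lter_normr.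
  have ui := u0 i; have uj := u0 j; move: yj; rewrite ler_norml => /andP[y1 y2].
  by case: (ltngtP i j) ij => // /u_half h _; lra.
(* So close to [q] only terms with [n <= j] are met, for which the [n]-th derivative is at most 1;
   and [u j / 2 <= y - q] on the support of the [j]-th term. *)
have Fsmall n y : `|y - q| < u n / 2 -> `|F n y| <= (y - q) ^+ 2.
  move=> yn; have [[j yj]|none] := pselect (exists j, `|y - (q + u j)| <= u j / 4).
    rewrite (Fone _ _ _ yj) /s normrM.
    have uj := u0 j; move: yj yn; rewrite ler_norml ltr_norml => yj yn.
    have nj : (n <= j)%N by rewrite leqNgt; apply/negP => /u_half; lra.
    rewrite ger0_norm ?sqr_ge0 // (le_trans (ler_wpM2l _ (bS j n y nj))) ?sqr_ge0 //.
    by rewrite mulr1 ler_sqr ?nnegrE; lra.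
  suff -> : F n y = 0 by rewrite normr0 sqr_ge0.
  rewrite /F; case: ifP => // _; rewrite big1 // => k _; apply: s0.
  by rewrite ltNge; apply/negP => yk; apply: none; exists k.
exists (F 0%N) => [|k y yk]; last by rewrite (Fone _ _ _ (ltW yk)) /s derive1n0.
apply: smoothR_tower => n y; have [yq|yq|->] := ltgtP y q.
- rewrite /F ifT ?ltW //; apply: (@near_eq_is_derive _ _ _ (cst 0)).
  by near=> z; rewrite /= ifT // ltW //; near: z; exact: lt_nbhsl.
- pose m := (y + q) / 2; have qm : q < m by rewrite /m; lra.
  have my : m < y by rewrite /m; lra.
  rewrite (FE _ m) ?ltW //.
  apply: (@near_eq_is_derive _ _ _ (fun y => \sum_(0 <= k < N m) s n y k)).
    by near=> z; rewrite (FE _ m) // ltW //; near: z; exact: lt_nbhsr.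
  rewrite !big_mkord.
  have -> : (fun y => \sum_(0 <= k < N m) s n y k)
      = \sum_(k < N m) (fun y => s n y k).
    by apply/funext => z; rewrite fct_sumE big_mkord.
  apply: is_derive_sum => k; apply: is_deriveZ; exact: smoothR_is_derive.
- rewrite /F lexx; apply: (@is_derive_quadratic _ _ (u n / 2)); last exact: Fsmall.
  by rewrite divr_gt0.
Unshelve. all: by end_near. Qed.

End FlatSeries.

(** A C^2 bound near [p], expressed by symmetric first and second differences so that no derivative
    of [g] occurs. *)
Definition tame (R : realType) (g : R -> R) (C p r : R) := forall y h,
  `|y + h - p| < r -> `|y - h - p| < r ->
  `|g (y + h) - g (y - h)| <= C * `|h| /\
  `|g (y + h) - g y *+ 2 + g (y - h)| <= C * h ^+ 2.

(** * Locality of homogeneous maps, and boundedness near some points *)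

Section HomogeneousMaps.
Variable R : realType.
Variables (L : (R -> R) -> (R -> R) -> R -> R) (e : R).
Hypothesis L_homogeneous : forall h s t, smoothR h -> smoothR s -> smoothR t ->
  forall y, `|y| < e -> L (h \* s) (h \* t) y = h y * L s t y.
Hypothesis L_tame : forall s t, smoothR s -> smoothR t ->
  forall q, `|q| < e -> exists C r : R, 0 < r /\ tame (L s t) C q r.
Implicit Types (s t : R -> R).

Lemma smoothR_shifted_plateau r p : smoothR (fun y => plateau r (y - p) : R).
Proof.
have -> : (fun y => plateau r (y - p) : R) = plateau r \o horner ('X - p%:P).
  by apply/funext => y; rewrite /= !hornerE.
exact: smoothR_comp (smoothR_plateau r) (smoothR_horner _).
Qed.

(** A cut-off equal to 1 at [p] makes the two pairs equal; by homogeneity it changes neither value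
    at [p]. *)
Lemma L_local s t s' t' p r : smoothR s -> smoothR t -> smoothR s' -> smoothR t' ->
  `|p| < e -> 0 < r -> (forall y, `|y - p| < r -> s y = s' y /\ t y = t' y) ->
  L s t p = L s' t' p.
Proof.
move=> ss st ss' st' pe r0 eq_st; pose h y : R := plateau r (y - p).
have sh : smoothR h by exact: smoothR_shifted_plateau.
have hp : h p = 1 by rewrite /h subrr plateau1 ?normr0 ?divr_ge0 ?ltW.
have hE f f' : (forall y, `|y - p| < r -> f y = f' y) -> h \* f = h \* f'.
  move=> ff; apply/funext => y /=; case: (ltP `|y - p| r) => yr; first by rewrite ff.
  by rewrite /h plateau0 // !mul0r.
rewrite -[LHS]mul1r -[RHS]mul1r -hp -!L_homogeneous //.
by rewrite (hE s s') ?(hE t t') // => y /eq_st[].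
Qed.

Lemma L_bounded (q d : R) : `|q| < e -> 0 < d -> exists (p r : R) k (C : R),
  [/\ `|p - q| < d, 0 < r, forall y, `|y - p| < r -> `|y| < e, 0 < C &
    forall s t, smoothR s -> smoothR t -> supported p r s -> supported p r t ->
      cbounded k 1 s -> cbounded k 1 t -> tame (L s t) C p r].
Proof.
move=> qe d0; apply: contrapT => nex.
(* Halving leaves room for the intervals around [q + u k], which must stay within [d] of [q] and
   inside [|y| < e]. *)
pose d' := Num.min d (e - `|q|) / 2.
have d'0 : 0 < d' by rewrite divr_gt0 // lt_min d0 subr_gt0.
have d'd : d' * 2 <= d by rewrite divfK // ge_min lexx.
have d'e : d' * 2 <= e - `|q| by rewrite divfK // ge_min lexx orbT.
pose u k : R := d' / 2 ^+ k.
have u0 k : 0 < u k by rewrite divr_gt0 // exprn_gt0.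
have ud k : u k <= d'.
  rewrite ler_pdivrMr ?exprn_gt0 // ler_peMr ?(ltW d'0) //.
  by rewrite exprn_ege1 // ler1n.
have ue k y : `|y - (q + u k)| < u k / 4 -> `|y| < e.
  have := u0 k; have := ud k; have := normr_ge0 q; have := ler_norm q; have := ler_norm (- q).
  by rewrite normrN ltr_norml => ? ? ? ? ? /andP[? ?]; rewrite ltr_norml; lra.
pose c k := (u k / 2) ^+ 2.
have c0 k : 0 < c k by rewrite exprn_gt0 // divr_gt0.
(* The constant is divided by the weight [c k] of the series, so that in the image of the summed
   pair the constant [k.+1] is violated, for every [k]. *)
have bad k : exists st : (R -> R) * (R -> R),
    [/\ smoothR st.1, smoothR st.2, supported (q + u k) (u k / 4) st.1,
      supported (q + u k) (u k / 4) st.2 & cbounded k 1 st.1 /\ cbounded k 1 st.2]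
    /\ ~ tame (L st.1 st.2) (k.+1%:R / c k) (q + u k) (u k / 4).
  apply: contrapT => nbad; apply: nex.
  exists (q + u k), (u k / 4), k, (k.+1%:R / c k); split=> //.
  - rewrite addrAC subrr add0r gtr0_norm //; have := ud k; lra.
  - by rewrite divr_gt0.
  - exact: ue.
  - by rewrite divr_gt0.
  - move=> s t ss st ps pt bs bt; apply: contrapT => nt; apply: nbad.
    by exists (s, t).
have [ST {}bad] := choice bad.
have [V sV VE] : exists2 V, smoothR V & forall k y, `|y - (q + u k)| < u k / 4 ->
    V y = c k * (ST k).1 y.
  by apply: flat_series => // k; have [[? ? ? ? []]] := bad k.
have [W sW WE] : exists2 V, smoothR V & forall k y, `|y - (q + u k)| < u k / 4 ->
    V y = c k * (ST k).2 y.
  by apply: flat_series => // k; have [[? ? ? ? []]] := bad k.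
have [C [r [r0 tC]]] := L_tame sV sW qe.
have r20 : 0 < r / 2 by rewrite divr_gt0.
have [N NP] := geometric_small d'0 r20.
(* For this [k] the interval lies where the image of [(V, W)] is tame with constant [C], and
   [C <= k.+1]. *)
pose k := maxn N (Num.bound `|C|).
have kN : u k < r / 2 by apply: NP; rewrite leq_maxl.
have kC : C <= k.+1%:R.
  rewrite (le_trans (ler_norm C)) // (le_trans (ltW (archi_boundP (normr_ge0 C)))) //.
  by rewrite ler_nat ltnW // ltnS leq_maxr.
have [[ss st ps pt [bs bt]] []] := bad k.
have LE y : `|y - (q + u k)| < u k / 4 -> L V W y = c k * L (ST k).1 (ST k).2 y.
  move=> yk; rewrite -(L_homogeneous (smoothR_cst (c k)) ss st) ?(ue k) //.
  apply: (L_local (r := u k / 4 - `|y - (q + u k)|)) => //.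
  - by apply: smoothR_mul => //; exact: smoothR_cst.
  - by apply: smoothR_mul => //; exact: smoothR_cst.
  - exact: ue yk.
  - by rewrite subr_gt0.
  - move=> z zy; have zk : `|z - (q + u k)| < u k / 4.
      by rewrite (le_lt_trans (ler_distD y _ _)) // -ltrBrDr.
    by rewrite (VE _ _ zk) (WE _ _ zk).
move=> y h yh1 yh2.
have yy : `|y - (q + u k)| < u k / 4.
  by move: yh1 yh2; rewrite !ltr_norml; lra.
have near_q z : `|z - (q + u k)| < u k / 4 -> `|z - q| < r.
  by have := u0 k; rewrite !ltr_norml; lra.
have [] := tC y h (near_q _ yh1) (near_q _ yh2).
rewrite !LE //; set x1 := L _ _ (y + h); set x2 := L _ _ (y - h); set x3 := L _ _ y.
have -> : c k * x1 - c k * x2 = c k * (x1 - x2) by rewrite mulrBr.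
have -> : c k * x1 - (c k * x3) *+ 2 + c k * x2 = c k * (x1 - x3 *+ 2 + x2).
  by rewrite mulrDr mulrBr mulrnAr.
have nc z : `|c k * z| = c k * `|z| by rewrite normrM (gtr0_norm (c0 k)).
rewrite !nc -!ler_pdivlMl //.
have kCc : (c k)^-1 * C <= k.+1%:R / c k.
  by rewrite mulrC ler_wpM2r // invr_ge0 ltW.
move=> h1 h2; split; [apply: le_trans h1 _|apply: le_trans h2 _];
 by rewrite mulrA ler_wpM2r ?sqr_ge0.
Qed.
End HomogeneousMaps.

(** * Additivity near a point where the map is bounded *)

Section AdditivityAtGoodPoint.
Variable R : realType.
Variables (L : (R -> R) -> (R -> R) -> R -> R) (e : R).
Hypothesis L_homogeneous : forall h s t, smoothR h -> smoothR s -> smoothR t ->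
  forall y, `|y| < e -> L (h \* s) (h \* t) y = h y * L s t y.
Hypothesis L_tame : forall s t, smoothR s -> smoothR t ->
  forall q, `|q| < e -> exists C r : R, 0 < r /\ tame (L s t) C q r.
Variables (p r : R) (k : nat) (C : R).
Hypotheses (r0 : 0 < r) (C0 : 0 < C).
Hypothesis pr_e : forall y, `|y - p| < r -> `|y| < e.
Hypothesis L_bound : forall s t, smoothR s -> smoothR t ->
  supported p r s -> supported p r t -> cbounded k 1 s -> cbounded k 1 t ->
  tame (L s t) C p r.
Implicit Types (s t : R -> R) (S T sigma : {poly R}) (y a : R).

Let Lp S T y := L (horner S) (horner T) y.

Lemma Lp_homogeneous (H S T : {poly R}) y : `|y| < e -> Lp (H * S) (H * T) y = H.[y] * Lp S T y.
Proof.
move=> ye; rewrite -L_homogeneous //; try exact: smoothR_horner.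
by congr (L _ _ y); apply/funext => z /=; rewrite hornerM.
Qed.

Lemma L_bound_scaled s t (B : R) : 0 < B -> smoothR s -> smoothR t ->
  supported p r s -> supported p r t -> cbounded k B s -> cbounded k B t ->
  tame (L s t) (C * B) p r.
Proof.
move=> B0 ss st ps pt bs bt.
have sc f : smoothR f -> smoothR (cst B^-1 \* f).
  by move=> sf; apply: smoothR_mul => //; exact: smoothR_cst.
have pc f : supported p r f -> supported p r (cst B^-1 \* f).
  by move=> pf y /pf /= ->; rewrite mulr0.
have bc f : smoothR f -> cbounded k B f -> cbounded k 1 (cst B^-1 \* f).
  move=> sf /(cboundedZ B^-1 sf).
  by rewrite gtr0_norm ?invr_gt0 // mulVf // gt_eqF.
have tL := L_bound (sc _ ss) (sc _ st) (pc _ ps) (pc _ pt) (bc _ ss bs) (bc _ st bt).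
move=> y h yh1 yh2.
have yy : `|y - p| < r by move: yh1 yh2; rewrite !ltr_norml; lra.
have [] := tL y h yh1 yh2.
rewrite !(L_homogeneous (smoothR_cst B^-1) ss st) ?pr_e //.
set x1 := L _ _ (y + h); set x2 := L _ _ (y - h); set x3 := L _ _ y.
rewrite /cst.
have -> : B^-1 * x1 - B^-1 * x2 = B^-1 * (x1 - x2) by rewrite mulrBr.
have -> : B^-1 * x1 - (B^-1 * x3) *+ 2 + B^-1 * x2 = B^-1 * (x1 - x3 *+ 2 + x2).
  by rewrite mulrDr mulrBr mulrnAr.
have nc z : `|B^-1 * z| = B^-1 * `|z| by rewrite normrM gtr0_norm // invr_gt0.
by rewrite !nc !ler_pdivrMl // !mulrA ![B * C]mulrC.
Qed.

Let phi y : R := plateau r (y - p).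

Let sphi : smoothR phi. Proof. exact: smoothR_shifted_plateau. Qed.

Let phi1 y : `|y - p| <= r / 2 -> phi y = 1. Proof. exact: plateau1. Qed.

Let phi_supported f : supported p r (phi \* f).
Proof. by move=> y yr /=; rewrite /phi plateau0 // mul0r. Qed.

Let smooth_phiM S : smoothR (phi \* horner S).
Proof. by apply: smoothR_mul => //; exact: smoothR_horner. Qed.

Lemma cutoff_cbounded S : exists2 B, 0 < B & cbounded k B (phi \* horner S).
Proof. exact: supported_cbounded r0 (smooth_phiM S) (@phi_supported _). Qed.

(** Cut-off monomials: rescaled to size [rho] around [y0], they perturb a function near [y0] and
    leave it unchanged at distance at least [rho / 2]. *)
Let chi i (z : R) : R := z ^+ i * plateau (1 / 2) z.

Let half0 : 0 < 1 / 2 :> R. Proof. by rewrite divr_gt0. Qed.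

Let schi i : smoothR (chi i).
Proof.
have -> : chi i = horner 'X^i \* plateau (1 / 2).
  by apply/funext => z; rewrite /chi /= hornerXn.
by apply: smoothR_mul; [exact: smoothR_horner|exact: smoothR_plateau].
Qed.

Let chi0 i z : 1 / 2 <= `|z| -> chi i z = 0.
Proof. by move=> z2; rewrite /chi plateau0 // mulr0. Qed.

Let chi1 i z : `|z| <= 1 / 4 -> chi i z = z ^+ i.
Proof. by move=> z4; rewrite /chi plateau1 ?mulr1 //; lra. Qed.

Lemma chi_cbounded i : exists2 B, 0 < B & cbounded k B (chi i).
Proof.
apply: (supported_cbounded k (p := 0) half0 (schi i)) => z.
by rewrite subr0; exact: chi0.
Qed.

Let Wpoly (N : nat) (b : nat -> R) (y0 : R) : {poly R} :=
  \sum_(i < N) (b i) *: ('X - y0%:P) ^+ i.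

(** A single pair is glued that equals the perturbed polynomials near [y0] and the unperturbed ones
    near [y0 + rho]. The bounds on the coefficients keep its C^k norm bounded independently of
    [rho], so its image is Lipschitz with a uniform constant. *)
Lemma transition S T (N : nat) (A : R) : 0 <= A -> exists C' : R,
  forall rho y0 (b c : nat -> R), 0 < rho -> rho <= 1 -> rho <= r / 8 ->
    `|y0 - p| < r / 4 ->
    (forall i, (i < N)%N -> `|b i| * rho ^+ i <= A * rho ^+ k) ->
    (forall i, (i < N)%N -> `|c i| * rho ^+ i <= A * rho ^+ k) ->
    `|Lp (S + Wpoly N b y0) (T + Wpoly N c y0) y0 - Lp S T (y0 + rho)| <= C' * rho.
Proof.
move=> A0.
have chiB i : exists B, 0 < B /\ cbounded k B (chi i).
  by have [B] := chi_cbounded i; exists B.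
have {chiB} [B BP] := choice chiB.
have [BS BS0 BSP] := cutoff_cbounded S; have [BT BT0 BTP] := cutoff_cbounded T.
pose D := BS + BT + \sum_(i < N) A * B i.
have sum0 : 0 <= \sum_(i < N) A * B i.
  by apply: sumr_ge0 => i _; rewrite mulr_ge0 // ltW //; case: (BP i).
have D0 : 0 < D by rewrite ltr_wpDr // addr_gt0.
exists (C * D) => rho y0 b c rho0 rho1 rhor y0p bA cA.
pose V Q (d : nat -> R) : R -> R := (phi \* horner Q) \+ \sum_(i < N) rescale (d i * rho ^+ i) y0 rho (chi i).
have sV Q d : smoothR (V Q d).
  apply: smoothR_add => //; apply: smoothR_sum => i; exact: smoothR_rescale.
have VE Q d y : V Q d y
    = phi y * Q.[y] + \sum_(i < N) d i * rho ^+ i * chi i ((y - y0) / rho).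
  by rewrite /V /= fct_sumE.
have far Q d y : rho / 2 <= `|y - y0| -> V Q d y = phi y * Q.[y].
  move=> yy0; rewrite VE big1 ?addr0 // => i _; rewrite chi0 ?mulr0 //.
  by rewrite normrM normfV (gtr0_norm rho0) ler_pdivlMr // mulrC mul1r.
have close Q d y : `|y - y0| <= rho / 4 -> V Q d y = (Q + Wpoly N d y0).[y].
  move=> yy0; rewrite VE phi1 ?mul1r; last first.
    have := y0p; move: yy0; rewrite !ler_norml !ltr_norml; lra.
  rewrite hornerD horner_sum; congr (_ + _); apply: eq_bigr => i _.
  rewrite chi1; last by rewrite normrM normfV (gtr0_norm rho0) ler_pdivrMr // mulrC mul1r.
  rewrite !hornerE expr_div_n -mulrA [rho ^+ i * _]mulrC divfK //.
  by rewrite expf_neq0 // gt_eqF.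
have pV Q d : supported p r (V Q d).
  move=> y yr; rewrite far; first by rewrite /phi plateau0 // mul0r.
  have : `|y - p| <= `|y - y0| + `|y0 - p| by rewrite ler_distD.
  lra.
have bV Q d (BQ : R) : 0 < BQ -> BQ <= BS + BT -> cbounded k BQ (phi \* horner Q) ->
    (forall i, (i < N)%N -> `|d i| * rho ^+ i <= A * rho ^+ k) ->
    cbounded k D (V Q d).
  move=> BQ0 BQST bQ dA; apply: (cboundedW (B := BQ + \sum_(i < N) A * B i)).
    by rewrite lerD2r.
  apply: cboundedD => //.
    by apply: smoothR_sum => i; exact: smoothR_rescale.
  apply: cbounded_sum => i; first exact: smoothR_rescale.
  apply: cbounded_rescale => //; first by case: (BP i).
  by rewrite normrM [X in _ * X]ger0_norm ?exprn_ge0 ?(ltW rho0) // dA.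
have BSST : BS <= BS + BT by rewrite lerDl ltW.
have BTST : BT <= BS + BT by rewrite lerDr ltW.
have tV := L_bound_scaled D0 (sV S b) (sV T c) (pV S b) (pV T c)
  (bV S b BS BS0 BSST BSP bA) (bV T c BT BT0 BTST BTP cA).
(* Midpoint and half step are chosen so that the first difference compares [y0] with [y0 + rho]. *)
have [] := tV (y0 + rho / 2) (rho / 2).
- by move: y0p; rewrite !ltr_norml; lra.
- by move: y0p; rewrite !ltr_norml; lra.
rewrite addrK -addrA -splitr distrC => LV _.
have y0e : `|y0| < e by apply: pr_e; lra.
have y0re : `|y0 + rho| < e by apply: pr_e; move: y0p; rewrite !ltr_norml; lra.
have -> : Lp (S + Wpoly N b y0) (T + Wpoly N c y0) y0 = L (V S b) (V T c) y0.
  apply: (L_local L_homogeneous (r := rho / 4)) => //; try exact: smoothR_horner.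
    by rewrite divr_gt0.
  by move=> y /ltW yr; rewrite !close.
have -> : Lp S T (y0 + rho) = L (V S b) (V T c) (y0 + rho).
  apply: (L_local L_homogeneous (r := rho / 2)) => //; try exact: smoothR_horner.
    by rewrite divr_gt0.
  move=> y yr.
  have y1 : rho / 2 <= `|y - y0| by move: yr; rewrite ltr_norml lter_normr; lra.
  have y2 : `|y - p| <= r / 2.
    by move: yr y0p; rewrite ler_norml !ltr_norml; lra.
  by rewrite !far // phi1 // !mul1r.
rewrite (le_trans LV) // ler_pM2l ?mulr_gt0 //.
by rewrite gtr0_norm ?divr_gt0 //; lra.
Qed.

Lemma Lp_lipschitz S T q : `|q| < e -> exists C' d : R,
  [/\ 0 < d, 0 <= C' & forall y, `|y - q| < d -> `|Lp S T y - Lp S T q| <= C' * `|y - q|].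
Proof.
move=> qe; have [C' [d [d0 tL]]] := L_tame (smoothR_horner S) (smoothR_horner T) qe.
exists `|C'|, d; split=> // y yq.
have [] := tL ((y + q) / 2) ((y - q) / 2).
- by rewrite (_ : _ - q = y - q) //; lra.
- rewrite (_ : _ - q = 0) ?normr0 //; lra.
rewrite (_ : (y + q) / 2 + (y - q) / 2 = y); last lra.
rewrite (_ : (y + q) / 2 - (y - q) / 2 = q); last lra.
move=> + _ => /le_trans; apply; apply: (le_trans (y := `|C'| * `|(y - q) / 2|)).
  by rewrite ler_wpM2r // ler_norm.
by rewrite ler_wpM2l // normrM [X in _ * X]gtr0_norm ?ler_piMr // invf_le1 ?ler1n.
Qed.

(** Limits for [rho] tending to 0 are taken in this form: a fixed quantity is bounded by a multiple
    of every small [rho]. *)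
Lemma small_eq0 (x K d : R) : 0 < d ->
  (forall rho, 0 < rho -> rho < d -> `|x| <= K * rho) -> x = 0.
Proof.
move=> d0 xK; apply/eqP; rewrite -normr_le0; apply/ler_addgt0Pl => eps eps0.
rewrite addr0; pose rho := Num.min (d / 2) (eps / (`|K| + 1)).
have K1 : 0 < `|K| + 1 by rewrite ltr_wpDl.
have rho0 : 0 < rho by rewrite lt_min !divr_gt0.
have rhod : rho < d.
  by rewrite (le_lt_trans (y := d / 2)) ?ge_min ?lexx // ltr_pdivrMr // ltr_pMr // ltr1n.
rewrite (le_trans (xK rho rho0 rhod)) //.
apply: (le_trans (y := (`|K| + 1) * rho)).
  by rewrite ler_wpM2r ?(ltW rho0) // (le_trans (ler_norm K)) // lerDl.
by rewrite mulrC -ler_pdivlMr // ge_min lexx orbT.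
Qed.

(** When this holds in every degree above [m], only the [m]-jet of the first argument matters on
    polynomials with second argument 1. *)
Let insensitive m := forall sigma a y0, `|y0 - p| < r / 4 ->
  Lp (sigma + a *: ('X - y0%:P) ^+ m) 1 y0 = Lp sigma 1 y0.

Lemma base_e y0 : `|y0 - p| < r / 4 -> `|y0| < e.
Proof. by move=> y0p; apply: pr_e; move: y0p r0; lra. Qed.

Lemma Wpoly0 N y0 : Wpoly N (fun=> 0) y0 = 0.
Proof. by rewrite /Wpoly big1 // => i _; rewrite scale0r. Qed.

(** As [k <= m], a fixed multiple of the monomial is small enough for [transition], which passes to
    [y0 + rho] without the monomial; the Lipschitz bound leads back to [y0]. *)
Lemma insensitive_high m : (k <= m)%N -> insensitive m.
Proof.
move=> km sigma a y0 y0p.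
have [C1 C1P] := transition sigma 1 m.+1 (normr_ge0 a).
have [C2 [d [d0 _ C2P]]] := Lp_lipschitz sigma 1 (base_e y0p).
apply/eqP; rewrite -subr_eq0; apply/eqP.
apply: (@small_eq0 _ (C1 + C2) (Num.min d (Num.min 1 (r / 8)))).
  by rewrite !lt_min d0 divr_gt0 //= ltr01.
move=> rho rho0; rewrite !lt_min => /andP[rd /andP[/ltW r1 /ltW r8]].
pose b i := if i == m then a else 0 : R.
have := C1P rho y0 b (fun=> 0) rho0 r1 r8 y0p.
have -> : Wpoly m.+1 b y0 = a *: ('X - y0%:P) ^+ m.
  rewrite /Wpoly (bigD1 ord_max) //= /b eqxx big1 ?addr0 // => i im.
  by rewrite -val_eqE /= in im; rewrite (negbTE im) scale0r.
rewrite Wpoly0 addr0 => H.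
have {}H : `|Lp (sigma + a *: ('X - y0%:P) ^+ m) 1 y0 - Lp sigma 1 (y0 + rho)| <= C1 * rho.
  apply: H => i _; last by rewrite normr0 mul0r mulr_ge0 // exprn_ge0 // ltW.
  rewrite /b; case: eqP => [->|_]; last by rewrite normr0 mul0r mulr_ge0 // exprn_ge0 // ltW.
  by rewrite ler_wpM2l // ler_wiXn2l // ltW.
have := C2P (y0 + rho); rewrite addrAC subrr add0r gtr0_norm // => /(_ rd) H2.
by rewrite (le_trans (ler_distD (Lp sigma 1 (y0 + rho)) _ _)) // mulrDl lerD.
Qed.

(** * The induction step: dependence on the coefficient of degree [m] *)

Section SecondDifference.
Variable m : nat.
Hypothesis insensitive_above : forall j, (m < j)%N -> insensitive j.

(** Both sides are expanded in powers of ['X - y1]. The correction [b] has no term of degree [m],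
    and a factor [delta] in every lower degree. *)
Lemma blowup_identity sigma (delta h y0 : R) : delta != 0 ->
  let y1 := y0 + delta * h in
  let b i := (delta * h) ^+ (m - i) * h * ('C(m.+1, i)%:R - m.+1%:R * 'C(m, i)%:R) in
  sigma + delta^-1 *: ('X - y0%:P) ^+ m.+1
  = sigma + (m.+1%:R * h) *: ('X - y0%:P) ^+ m + Wpoly m.+1 b y1
    + delta^-1 *: ('X - y1%:P) ^+ m.+1.
Proof.
move=> delta0 y1 b; set Z := 'X - y1%:P.
have XZ : 'X - y0%:P = (delta * h)%:P + Z by rewrite /Z /y1 polyCD; ring.
have pw n : ((delta * h)%:P + Z) ^+ n
    = \sum_(i < n.+1) ((delta * h) ^+ (n - i) * 'C(n, i)%:R) *: Z ^+ i.
  rewrite exprDn; apply: eq_bigr => i _.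
  by rewrite -polyC_exp mul_polyC -scaler_nat scalerA mulrC.
rewrite XZ !pw big_ord_recr /= subnn expr0 binn !mul1r scale1r scalerDr.
rewrite -!addrA; congr (_ + _); rewrite addrA; congr (_ + _).
rewrite /Wpoly !scaler_sumr -big_split /=; apply: eq_bigr => i _.
have im : (i <= m)%N by rewrite -ltnS.
rewrite !scalerA -scalerDl; congr (_ *: _).
by rewrite /b subSn // exprS; field.
Qed.

(* Rescaling by [delta] turns the coefficient of the perturbation into the
   point at which one fixed polynomial is observed: the germ of
   [('X - y0) ^ (m + 1) / delta] at [y0 + delta * h] is, up to terms that do not
   matter, [(m + 1) * h * ('X - y0) ^ m]. *)
Lemma blowup_limit sigma h y0 : `|y0 - p| < r / 4 -> exists K d : R, 0 < d /\
  forall rho, 0 < rho -> rho < d ->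
    `|Lp (sigma + (rho ^+ k.+1)^-1 *: ('X - y0%:P) ^+ m.+1) 1 (y0 + rho ^+ k.+1 * h)
      - Lp (sigma + (m.+1%:R * h) *: ('X - y0%:P) ^+ m) 1 y0| <= K * rho.
Proof.
move=> y0p; set tau := sigma + (_ * h) *: _.
pose g i := h ^+ (m - i) * h * ('C(m.+1, i)%:R - m.+1%:R * 'C(m, i)%:R) : R.
pose A := \sum_(i < m.+1) `|g i|.
have A0 : 0 <= A by rewrite sumr_ge0.
have [C1 C1P] := transition tau 1 m.+1 A0.
have [C2 [d [d0 C20 C2P]]] := Lp_lipschitz tau 1 (base_e y0p).
have h1 : 0 < `|h| + 1 by rewrite ltr_wpDl.
pose room := r / 4 - `|y0 - p|.
have room0 : 0 < room by rewrite subr_gt0.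
exists (C1 + C2 * (`|h| + 1)).
exists (Num.min (Num.min d room / (`|h| + 1)) (Num.min 1 (r / 8))).
rewrite !lt_min ltr01 !divr_gt0 ?lt_min ?d0 //; split=> // rho rho0.
rewrite !lt_min ltr_pdivlMr // lt_min.
move=> /andP[/andP[rd rroom] /andP[/ltW r1 /ltW r8]].
set delta := rho ^+ k.+1.
have delta0 : 0 < delta by rewrite exprn_gt0.
have delta_rho : delta <= rho by rewrite /delta exprS ler_piMr ?(ltW rho0) // exprn_ile1 // ltW.
have delta1 : delta <= 1 by exact: le_trans r1.
have dh : `|delta * h| <= rho * `|h| by rewrite normrM gtr0_norm // ler_wpM2r.
pose y1 := y0 + delta * h.
have y1p : `|y1 - p| < r / 4.
  have : `|y1 - p| <= `|delta * h| + `|y0 - p|.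
    by rewrite /y1 addrAC addrC; exact: ler_normD.
  by move: rroom; rewrite /room; lra.
have := blowup_identity sigma h y0 (lt0r_neq0 delta0).
cbv zeta; rewrite -/tau -/y1; set b := fun i : nat => _ => ->.
rewrite insensitive_above //.
have bE i : (i <= m)%N -> b i = delta ^+ (m - i) * g i.
  by move=> im; rewrite /b /g exprMn; ring.
have bA i : (i < m.+1)%N -> `|b i| * rho ^+ i <= A * rho ^+ k.
  rewrite ltnS => im; rewrite bE // normrM.
  have gA : `|g i| <= A.
    rewrite /A (bigD1 (Ordinal (im : (i < m.+1)%N))) //= lerDl sumr_ge0 //.
  have ri1 : rho ^+ i <= 1 by rewrite exprn_ile1 // ltW.
  have rk0 : 0 <= rho ^+ k by rewrite exprn_ge0 // ltW.
  (* In degree [m] the coefficient is 0 because ['C(m.+1, m) = m.+1]. In lower degrees the factor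
     [delta = rho ^+ k.+1] supplies the power [rho ^+ k]. *)
  have [->|imlt] := eqVneq i m.
    rewrite /g subnn expr0 mul1r binn (binSn m) mulr1 subrr mulr0 normr0 mulr0 mul0r.
    exact: mulr_ge0.
  have drk : delta ^+ (m - i) <= rho ^+ k.
    apply: (le_trans (y := delta)).
      rewrite -[leRHS]expr1 ler_wiXn2l ?(ltW delta0) // subn_gt0.
      by rewrite ltn_neqAle imlt.
    by rewrite /delta exprS ler_piMl.
  have dmi0 : 0 <= delta ^+ (m - i) by rewrite exprn_ge0 // ltW.
  rewrite (ger0_norm dmi0) (le_trans (y := delta ^+ (m - i) * `|g i|)) //.
    by rewrite ler_piMr // mulr_ge0.
  by rewrite mulrC ler_pM.
have := C1P rho y1 b (fun=> 0) rho0 r1 r8 y1p bA.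
rewrite Wpoly0 addr0 => H.
have {}H : `|Lp (tau + Wpoly m.+1 b y1) 1 y1 - Lp tau 1 (y1 + rho)| <= C1 * rho.
  by apply: H => i _; rewrite normr0 mul0r mulr_ge0 // exprn_ge0 // ltW.
have y1y0 : `|y1 + rho - y0| <= rho * (`|h| + 1).
  rewrite (_ : y1 + rho - y0 = delta * h + rho); last by rewrite /y1; lra.
  by rewrite mulrDr mulr1 (le_trans (ler_normD _ _)) // lerD // gtr0_norm.
have := C2P (y1 + rho) (le_lt_trans y1y0 rd).
move=> H2; rewrite (le_trans (ler_distD (Lp tau 1 (y1 + rho)) _ _)) // mulrDl lerD //.
by rewrite (le_trans H2) // -mulrA ler_wpM2l // mulrC.
Qed.

(** The pair [(delta * sigma + Q, delta)] stays bounded as [delta] tends to 0, and its image is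
    [delta * psi]. Its second difference with step [delta * h] is of order [delta ^+ 2], so that of
    [psi] tends to 0. By [blowup_limit] the outer values of [psi] tend to the two summands on the
    left; the middle one does not see [Q]. *)
Lemma second_difference0 sigma c y0 : `|y0 - p| < r / 4 ->
  Lp (sigma + c *: ('X - y0%:P) ^+ m) 1 y0 + Lp (sigma - c *: ('X - y0%:P) ^+ m) 1 y0
  = Lp sigma 1 y0 *+ 2.
Proof.
move=> y0p; pose h := c / m.+1%:R; pose Q : {poly R} := ('X - y0%:P) ^+ m.+1.
have cE : m.+1%:R * h = c by rewrite mulrC divfK // pnatr_eq0.
have [K1 [d1 [d10 K1P]]] := blowup_limit sigma h y0p.
have [K2 [d2 [d20 K2P]]] := blowup_limit sigma (- h) y0p.
rewrite mulrN cE scaleNr in K2P; rewrite cE in K1P.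
have [B1 B10 B1P] := cutoff_cbounded sigma; have [B2 B20 B2P] := cutoff_cbounded Q.
have [B3 B30 B3P] := cutoff_cbounded 1.
pose D := B1 + B2 + B3; have D0 : 0 < D by rewrite !addr_gt0.
apply/eqP; rewrite -subr_eq0; apply/eqP.
apply: (@small_eq0 _ (K1 + K2 + C * D * h ^+ 2)
  (Num.min (Num.min d1 d2) (Num.min 1 (r / 4 / (`|h| + 1))))).
  by rewrite !lt_min d10 d20 ltr01 !divr_gt0 // ltr_wpDl.
move=> rho rho0; rewrite !lt_min => /andP[/andP[rd1 rd2] /andP[/ltW r1 rh]].
have := K1P rho rho0 rd1; have := K2P rho rho0 rd2.
set delta := rho ^+ k.+1; rewrite mulrN -/Q.
have delta0 : 0 < delta by rewrite exprn_gt0.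
have delta_rho : delta <= rho by rewrite /delta exprS ler_piMr ?(ltW rho0) // exprn_ile1 // ltW.
have delta1 : delta <= 1 by exact: le_trans r1.
have dh : `|delta * h| < r / 4.
  move: rh; rewrite ltr_pdivlMr ?ltr_wpDl // => rh.
  rewrite normrM gtr0_norm // (le_lt_trans _ rh) //.
  by rewrite mulrDr mulr1 ler_wpDr ?(ltW rho0) // ler_wpM2r.
pose psi y := Lp (sigma + delta^-1 *: Q) 1 y.
pose S := delta *: sigma + Q.
have LpE y : `|y| < e -> Lp S delta%:P y = delta * psi y.
  move=> ye; rewrite -[in RHS](hornerC delta y) -Lp_homogeneous // mulr1.
  congr (Lp _ _ y).
  by rewrite /S mul_polyC scalerDr scalerA mulfV ?scale1r ?gt_eqF.
have bS : cbounded k D (phi \* horner S).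
  have -> : phi \* horner S = (cst delta \* (phi \* horner sigma)) \+ (phi \* horner Q).
    by apply/funext => y; rewrite /S /= hornerD hornerZ; ring.
  apply: (cboundedW (B := `|delta| * B1 + B2)).
    rewrite gtr0_norm // /D -addrA lerD //; last by rewrite lerDl ltW.
    by rewrite ler_piMl // ltW.
  apply: cboundedD => //; last exact: cboundedZ.
  by apply: smoothR_mul => //; exact: smoothR_cst.
have bT : cbounded k D (phi \* horner delta%:P).
  have -> : phi \* horner delta%:P = cst delta \* (phi \* horner 1).
    by apply/funext => y; rewrite /= !hornerC; ring.
  apply: (cboundedW (B := `|delta| * B3)); last exact: cboundedZ.
  rewrite gtr0_norm // (le_trans (y := B3)) ?ler_piMl ?(ltW B30) //.
  by rewrite lerDr addr_ge0 // ltW.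
have tV := L_bound_scaled D0 (smooth_phiM S) (smooth_phiM delta%:P)
  (@phi_supported _) (@phi_supported _) bS bT.
have VE y : `|y - p| < r / 2 ->
    L (phi \* horner S) (phi \* horner delta%:P) y = delta * psi y.
  move=> yp; have ye : `|y| < e by apply: pr_e; move: yp r0; lra.
  rewrite L_homogeneous //; try exact: smoothR_horner.
  by rewrite phi1 ?ltW // mul1r; exact: LpE.
have y1p : `|y0 + delta * h - p| < r / 2 by move: y0p dh; rewrite !ltr_norml; lra.
have y2p : `|y0 - delta * h - p| < r / 2 by move: y0p dh; rewrite !ltr_norml; lra.
have [] := tV y0 (delta * h).
- by apply: lt_trans y1p _; move: r0; lra.
- by apply: lt_trans y2p _; move: r0; lra.
move=> _; rewrite !VE //; last by move: y0p r0; lra.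
rewrite -mulrnAr -mulrBr -mulrDr normrM (gtr0_norm delta0).
have -> : C * D * (delta * h) ^+ 2 = delta * (C * D * h ^+ 2 * delta) by ring.
rewrite ler_pM2l // {2}/psi insensitive_above // -/(psi _) -/(psi _).
rewrite -/(psi (y0 - _)) -/(psi (y0 + _)).
have : C * D * h ^+ 2 * delta <= C * D * h ^+ 2 * rho.
  by rewrite ler_wpM2l // mulr_ge0 ?sqr_ge0 // mulr_ge0 // ltW.
rewrite !mulrDl.
move: (Lp sigma 1 y0) (psi _) (psi _) (Lp _ 1 y0) (Lp _ 1 y0) => x0 x1 x2 x3 x4.
by rewrite !ler_norml; lra.
Qed.

(** Division by [n] turns the pair into [(a *: Q + sigma / n, 1 / n)], a small perturbation of
    [(a *: Q, 0)]. The latter is evaluated at [y0 + rho] by homogeneity. *)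
Lemma growth sigma a y0 : `|y0 - p| < r / 4 -> exists K d : R, 0 < d /\
  forall rho, 0 < rho -> rho < d -> exists n : nat, [/\ (0 < n)%N, n%:R^-1 <= rho &
    `|Lp (sigma + (n%:R * a) *: ('X - y0%:P) ^+ m) 1 y0 / n%:R
      - a * rho ^+ m * Lp 1 0 (y0 + rho)| <= K * rho].
Proof.
move=> y0p; set Q := ('X - y0%:P) ^+ m.
(* The coefficients of [sigma] at [y0]. The successor makes [N] positive, so that degree 0 is
   available for the constant [1 / n]. *)
pose s' := sigma \Po ('X + y0%:P); pose N := (size s').+1.
have sE : sigma = Wpoly N (fun i => s'`_i) y0.
  have -> : sigma = s' \Po ('X - y0%:P).
    by rewrite /s' -comp_polyA comp_polyD comp_polyX comp_polyC subrK comp_polyXr.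
  by rewrite comp_polyE /Wpoly big_ord_recr /= nth_default // scale0r addr0.
pose A := 1 + \sum_(i < N) `|s'`_i|.
have A0 : 0 <= A by rewrite addr_ge0 // sumr_ge0.
have [C1 C1P] := transition (a *: Q) 0 N A0.
exists C1, (Num.min 1 (r / 8)); rewrite !lt_min ltr01 divr_gt0 //.
split=> // rho rho0; rewrite lt_min => /andP[/ltW r1 /ltW r8].
have rk0 : 0 < rho ^+ k.+1 by rewrite exprn_gt0.
(* Then [1 / n <= rho ^+ k.+1], which makes the coefficients divided by [n] small enough for
   [transition]. *)
pose n := (Num.bound (rho ^+ k.+1)^-1).+1.
have nrk : n%:R^-1 <= rho ^+ k.+1.
  rewrite -[leRHS]invrK lef_pV2 ?posrE ?invr_gt0 ?ltr0n //.
  rewrite (le_trans (ltW (archi_boundP _))) ?ler_nat //.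
  by rewrite invr_ge0 ltW.
have rkk : rho ^+ k.+1 <= rho ^+ k by rewrite ler_wiXn2l // ltW.
have n0 : 0 <= n%:R^-1 :> R by rewrite invr_ge0 ler0n.
have nn0 : n%:R != 0 :> R by rewrite pnatr_eq0.
exists n; split=> //.
  by rewrite (le_trans nrk) // exprS ler_piMr ?(ltW rho0) // exprn_ile1 // ltW.
pose b i := n%:R^-1 * s'`_i; pose c i := if i == 0%N then n%:R^-1 else 0 : R.
have := C1P rho y0 b c rho0 r1 r8 y0p.
have ri1 i : rho ^+ i <= 1 by rewrite exprn_ile1 // ltW.
have bnd x i : `|x| <= A -> `|n%:R^-1 * x| * rho ^+ i <= A * rho ^+ k.
  move=> xA; rewrite normrM (ger0_norm n0).
  rewrite (le_trans (y := n%:R^-1 * `|x|)) ?ler_piMr ?mulr_ge0 //.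
  by rewrite mulrC ler_pM // (le_trans nrk).
have -> : Wpoly N b y0 = n%:R^-1 *: sigma.
  rewrite [in RHS]sE /Wpoly scaler_sumr; apply: eq_bigr => i _.
  by rewrite scalerA.
have -> : Wpoly N c y0 = (n%:R^-1)%:P.
  rewrite /Wpoly (bigD1 ord0) //= expr0 alg_polyC big1 ?addr0 // => i.
  by rewrite -val_eqE /= /c => /negbTE ->; rewrite scale0r.
rewrite add0r => H.
have {}H := H _ _.
have y0e := base_e y0p.
have y1e : `|y0 + rho| < e by apply: pr_e; move: y0p r0 rho0; rewrite !ltr_norml; lra.
have LQ : Lp (a *: Q) 0 (y0 + rho) = a * rho ^+ m * Lp 1 0 (y0 + rho).
  have <- : (a *: Q).[y0 + rho] = a * rho ^+ m.
    by rewrite /Q !hornerE addrAC subrr add0r.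
  by rewrite -Lp_homogeneous // mulr1 mulr0.
rewrite -LQ.
have -> : Lp (sigma + (n%:R * a) *: Q) 1 y0 / n%:R
    = Lp (a *: Q + n%:R^-1 *: sigma) (n%:R^-1)%:P y0.
  rewrite mulrC -[in LHS](hornerC n%:R^-1 y0) -Lp_homogeneous // mulr1.
  congr (Lp _ _ y0); rewrite mul_polyC scalerDr scalerA mulrA mulVf // mul1r addrC //.
apply: H => i iN.
  apply: bnd; rewrite /A (bigD1 (Ordinal iN)) //= addrCA lerDl addr_ge0 //.
  by rewrite sumr_ge0.
rewrite /c; case: eqP => _.
  by rewrite -[X in `|X|]mulr1 bnd // normr1 lerDl sumr_ge0.
by rewrite normr0 mul0r mulr_ge0 // exprn_ge0 // ltW.
Qed.

(** Vanishing second differences make the value affine along the multiples of [a], and [growth]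
    computes the slope. The factor [0 ^+ m] is 1 for [m = 0] and 0 otherwise, so one formula serves
    both cases. *)
Lemma increment sigma a y0 : `|y0 - p| < r / 4 ->
  Lp (sigma + a *: ('X - y0%:P) ^+ m) 1 y0 - Lp sigma 1 y0 = a * 0 ^+ m * Lp 1 0 y0.
Proof.
move=> y0p; set Q := ('X - y0%:P) ^+ m.
pose om z := Lp (sigma + z *: Q) 1 y0.
have om2 z : om (z + a) + om (z - a) = om z *+ 2.
  rewrite /om scalerDl scalerBl !addrA; exact: second_difference0.
have omn n : om (n%:R * a) = om 0 + n%:R * (om a - om 0)
    /\ om (n.+1%:R * a) = om 0 + n.+1%:R * (om a - om 0).
  elim: n => [|n [IH1 IH2]]; first by rewrite !mul0r !mul1r addr0 addrC subrK.
  split=> //; have := om2 (n.+1%:R * a).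
  have -> : n.+1%:R * a + a = n.+2%:R * a by rewrite -[n.+2]addn1 natrD; ring.
  have -> : n.+1%:R * a - a = n%:R * a by rewrite -[n.+1]addn1 natrD; ring.
  move/eqP; rewrite -subr_eq0 => /eqP; rewrite IH1 IH2 -[n.+2]addn2 -[n.+1]addn1 !natrD.
  move=> H; apply/eqP; rewrite -subr_eq0; apply/eqP; rewrite -[RHS]H; ring.
have om0 : om 0 = Lp sigma 1 y0 by rewrite /om scale0r addr0.
rewrite -om0 -/(om a).
have [K [d [d0 KP]]] := growth sigma a y0p.
have [C2 [d2 [d20 C20 C2P]]] := Lp_lipschitz 1 0 (base_e y0p).
have am0 : exists C3, forall rho, 0 < rho -> rho <= 1 ->
    `|a * rho ^+ m - a * 0 ^+ m| <= C3 * rho.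
  exists `|a| => rho rho0 rho1; rewrite -mulrBr normrM ler_wpM2l //.
  case: (m) => [|m']; first by rewrite !expr0 subrr normr0 ltW.
  rewrite expr0n subr0 ger0_norm ?exprn_ge0 ?(ltW rho0) // exprS.
  by rewrite ler_piMr ?(ltW rho0) // exprn_ile1 // ltW.
have [C3 C3P] := am0.
apply/eqP; rewrite -subr_eq0; apply/eqP.
pose l := Lp 1 0 y0.
apply: (@small_eq0 _ (K + `|om 0| + C3 * `|l| + `|a| * C2) (Num.min d (Num.min d2 1))).
  by rewrite !lt_min d0 d20 ltr01.
move=> rho rho0; rewrite !lt_min => /and3P[rd rd2 /ltW r1].
have [n [n0 nrho]] := KP rho rho0 rd; rewrite -/Q -/(om _) (omn n).1.
have nn0 : n%:R != 0 :> R by rewrite pnatr_eq0 -lt0n.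
rewrite mulrDl mulrAC mulfV // mul1r => H1.
have H2 : `|om 0 / n%:R| <= `|om 0| * rho.
  by rewrite normrM ler_wpM2l // ger0_norm // invr_ge0 ler0n.
have H3 := C3P rho rho0 r1.
have H4 := C2P (y0 + rho); rewrite addrAC subrr add0r gtr0_norm // in H4.
have {}H4 := H4 rd2; rewrite -/l in H4 *; move: H1 H4; set l' := Lp 1 0 (y0 + rho).
move=> H1 H4.
have H5 : `|a * rho ^+ m * l' - a * 0 ^+ m * l| <= (C3 * `|l| + `|a| * C2) * rho.
  rewrite (_ : _ - _ = (a * rho ^+ m - a * 0 ^+ m) * l + a * rho ^+ m * (l' - l)); last ring.
  rewrite (le_trans (ler_normD _ _)) // !normrM mulrDl lerD //.
    by rewrite mulrAC ler_wpM2r // -normrM.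
  rewrite -!mulrA ler_wpM2l // -[leRHS]mul1r ler_pM // ger0_norm ?exprn_ge0 ?exprn_ile1 ?(ltW rho0) //.
rewrite !mulrDl; move: H1 H2 H5; rewrite mulrDl.
move: (om 0 / _) (a * rho ^+ m * l') (a * 0 ^+ m * l) (om a - om 0) => x1 x2 x3 x4.
by rewrite !ler_norml; lra.
Qed.

End SecondDifference.

(** Downward induction on [m], starting from [k]: in positive degree the increment carries the
    factor [0 ^+ m = 0]. *)
Lemma insensitive_positive m : (0 < m)%N -> insensitive m.
Proof.
have [d dk] : exists d, (k <= m + d)%N by exists k; rewrite leq_addl.
elim: d m dk => [|d IH] m dk m0; first by rewrite addn0 in dk; exact: insensitive_high.
move=> sigma a y0 y0p; apply/eqP; rewrite -subr_eq0 increment //.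
  by rewrite expr0n gtn_eqF // mulr0 mul0r.
move=> j mj; apply: IH; last exact: leq_trans mj.
by rewrite (leq_trans dk) // addnS -addSn leq_add2r.
Qed.

(** The increment in degree 0, where the monomial is the constant 1, with [sigma = 0] and
    [a = 1]. *)
Lemma additive_near y0 : `|y0 - p| < r / 4 -> Lp 1 1 y0 = Lp 0 1 y0 + Lp 1 0 y0.
Proof.
move=> y0p; have := @increment 0%N insensitive_positive 0 1 y0 y0p.
rewrite expr0 scale1r add0r expr0 !mul1r => /eqP.
by rewrite subr_eq addrC => /eqP.
Qed.

End AdditivityAtGoodPoint.

(** * Additivity at the origin as a limit of good points *)

Section Additivity.
Variable R : realType.
Variables (L : (R -> R) -> (R -> R) -> R -> R) (e : R).
Hypothesis L_homogeneous : forall h s t, smoothR h -> smoothR s -> smoothR t ->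
  forall y, `|y| < e -> L (h \* s) (h \* t) y = h y * L s t y.
Hypothesis L_tame : forall s t, smoothR s -> smoothR t ->
  forall q, `|q| < e -> exists C r : R, 0 < r /\ tame (L s t) C q r.

(** Good points exist arbitrarily close to 0, and each of the three values is Lipschitz at 0. *)
Lemma homogeneous_additive : 0 < e ->
  L (cst 1) (cst 1) 0 = L (cst 0) (cst 1) 0 + L (cst 1) (cst 0) 0.
Proof.
move=> e0; have h0 : `|0 : R| < e by rewrite normr0.
have cE c : cst c = horner c%:P :> (R -> R) by apply/funext => y; rewrite hornerC.
rewrite !cE !polyC1 !polyC0.
have lip := Lp_lipschitz L_tame.
have [C1 [d1 [d10 C10 C1P]]] := lip 1 1 0 h0.
have [C2 [d2 [d20 C20 C2P]]] := lip 0 1 0 h0.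
have [C3 [d3 [d30 C30 C3P]]] := lip 1 0 0 h0.
apply/eqP; rewrite -subr_eq0; apply/eqP.
apply: (@small_eq0 _ _ (C1 + C2 + C3) (Num.min d1 (Num.min d2 d3))).
  by rewrite !lt_min d10 d20.
move=> rho rho0; rewrite !lt_min => /and3P[r1 r2 r3].
have [p [r [k [C [pq r0 pr C0 LB]]]]] := L_bounded L_homogeneous L_tame h0 rho0.
have := additive_near L_homogeneous L_tame r0 C0 pr LB (y0 := p).
rewrite subrr normr0 divr_gt0 // => /(_ isT).
have := C1P p (lt_trans pq r1); have := C2P p (lt_trans pq r2); have := C3P p (lt_trans pq r3).
move: pq; rewrite subr0; move: `|p| => q qr.
have q1 : C1 * q <= C1 * rho by rewrite ler_wpM2l // ltW.
have q2 : C2 * q <= C2 * rho by rewrite ler_wpM2l // ltW.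
have q3 : C3 * q <= C3 * rho by rewrite ler_wpM2l // ltW.
rewrite !mulrDl !ler_norml; lra.
Qed.

End Additivity.

(** * Cut-off functions and the bracket at a point *)

Section SmoothLocality.
Variables (R : realType) (n : nat) (M : manifold R n).
Implicit Types (U V K : set M) (f g phi : M -> R).

Lemma msmooth_onU U V f :
  msmooth_on U f -> msmooth_on V f -> msmooth_on (U `|` V) f.
Proof.
move=> Uf Vf c ac j.
apply: (ndifferentiable_on_sub _ (ndifferentiable_onU (Uf c ac j) (Vf c ac j))).
by move=> y [cy [Uy|Vy]]; [left|right].
Qed.

Lemma eq_msmooth_on U f g : open U -> (forall q, U q -> f q = g q) ->
  msmooth_on U f -> msmooth_on U g.
Proof.
move=> oU fg sf c ac j; apply: eq_ndifferentiable_on (sf c ac j).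
  exact: coord_open.
by move=> y [_ /fg].
Qed.

(** [V] is covered by its intersection with [U], where both factors are smooth, and its part outside
    [K], where the product is 0. *)
Lemma msmooth_on_mul_support U V K phi g : open U -> open V -> closed K ->
  K `<=` U -> (forall q, ~ K q -> phi q = 0) ->
  msmooth_on V phi -> msmooth_on (V `&` U) g -> msmooth_on V (phi \* g).
Proof.
move=> oU oV cK KU phi0 sphi sg.
have oVU : open (V `&` U) by exact: openI.
have oVK : open (V `&` ~` K) by apply: openI => //; exact: closed_openC.
have -> : V = (V `&` U) `|` (V `&` ~` K).
  rewrite -setIUr; apply/esym/setIidPl => q _.
  by have [/KU|] := pselect (K q); [left|right].
apply: msmooth_onU.
  by apply: msmooth_onM => //; apply: msmooth_on_sub sphi => // q [].
apply: eq_msmooth_on (msmooth_on_cst 0 oVK) => // q [_ Kq] /=.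
by rewrite phi0 // mul0r.
Qed.

Lemma msmooth_on_prod (I : finType) U (F : I -> M -> R) : open U ->
  (forall i, msmooth_on U (F i)) -> msmooth_on U (fun q => \prod_i F i q).
Proof.
move=> oU sF; have -> : (fun q => \prod_i F i q) = \prod_i F i.
  by apply/funext => q; rewrite fct_prodE.
apply: (big_ind (msmooth_on U)) => [|f g|i _] //.
  exact: msmooth_on_cst.
exact: msmooth_onM.
Qed.

Lemma msmooth_on_comp U (s : R -> R) f : open U -> smoothR s -> msmooth_on U f ->
  msmooth_on U (s \o f).
Proof.
move=> oU ss sf c ac.
exact: (smooth_on_comp (coord_open oU) ss (sf c ac)).
Qed.

Lemma msmooth_on_coord (c : chart R n M) i : atlas c ->
  msmooth_on (dom c) (fun q => to_coord c q ord0 i).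
Proof. by move=> ac d ad; apply: atlas_smooth. Qed.

Definition box (a : 'rV[R]_n) (e : R) : set 'rV[R]_n :=
  [set y | forall i, `|y ord0 i - a ord0 i| <= e].

(** The box is compact, hence so is its image, which is then closed because [M] is Hausdorff.
    Closedness allows extension by zero outside the chart. *)
Lemma of_coord_box_closed (c : chart R n M) (a : 'rV[R]_n) (e : R) :
  box a e `<=` cod c ->
  closed (of_coord c @` box a e).
Proof.
move=> Bc; apply: compact_closed; first exact: points_hausdorff.
apply: continuous_compact.
  by apply: continuous_in_subspaceT => y /set_mem /Bc /of_coord_continuous.
have -> : box a e
        = [set y | forall i, `[a ord0 i - e, a ord0 i + e]%classic (y ord0 i)].
  by apply/funext => y; apply/propext; split=> + i => /(_ i);
     rewrite /= in_itv /= ler_distl.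
apply: (@rV_compact _ _ (fun i => `[a ord0 i - e, a ord0 i + e]%classic)) => i.
exact: segment_compact.
Qed.

Lemma open_box (a : 'rV[R]_n) (W : set 'rV[R]_n) : open W -> W a ->
  exists2 e : R, 0 < e & box a e `<=` W.
Proof.
move=> oW Wa; have /nbhs_ballP[e /= e0 eW] := open_nbhs_nbhs (conj oW Wa).
exists (e / 2) => [|y ye]; first by rewrite divr_gt0.
apply: eW; split => // i j; rewrite (ord1 i) /ball /= distrC.
by rewrite (le_lt_trans (ye j)) // ltr_pdivrMr // ltr_pMr // ltr1n.
Qed.

(** A product of plateaus in the coordinates of a chart at [x], extended by zero. *)
Lemma smooth_bump U (x : M) : open U -> U x ->
  exists (K : set M) (phi : cinfty M),
    [/\ closed K, K `<=` U, forall q, ~ K q -> phi q = 0 &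
      exists2 V : set M, open V /\ V x & forall q, V q -> phi q = 1].
Proof.
move=> oU Ux; have [c ac cx] := atlas_cover x.
pose a := to_coord c x.
have Wa : (cod c `&` of_coord c @^-1` U) a.
  by split; [exact: to_cod|rewrite /= to_coordK].
have [e e0 eW] := open_box (coord_open oU) Wa.
pose K := of_coord c @` box a e.
have cK : closed K by apply: of_coord_box_closed => y /eW[].
have KU : K `<=` U by move=> _ [y /eW[_ Uy] <-].
have Kc : K `<=` dom c by move=> _ [y /eW[cy _] <-]; exact: of_dom.
pose b p := \prod_i plateau e (to_coord c p ord0 i - a ord0 i).
pose phi p := if p \in dom c then b p else 0.
have b0 p : dom c p -> ~ K p -> b p = 0.
  move=> cp Kp; apply/eqP/negPn/negP => /prodf_neq0 bp; apply: Kp.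
  exists (to_coord c p); last exact: to_coordK.
  move=> i; have := bp i isT; apply: contraNT; rewrite -ltNge => /ltW ei.
  by rewrite plateau0.
have phi0 p : ~ K p -> phi p = 0.
  by rewrite /phi; case: ifPn => // /set_mem; exact: b0.
have od := dom_open c.
have sb : msmooth_on (dom c) b.
  apply: msmooth_on_prod => // i.
  have sN := msmooth_onD od (msmooth_on_coord i ac) (msmooth_on_cst (- a ord0 i) od).
  exact: (msmooth_on_comp od (smoothR_plateau e) sN).
have sphi : msmooth_on setT phi.
  have -> : setT = dom c `|` ~` K.
    apply/esym; rewrite -subTset => p _.
    by have [/Kc|] := pselect (K p); [left|right].
  apply: msmooth_onU.
    by apply: eq_msmooth_on sb => // p cp; rewrite /phi mem_set.
  have oK := closed_openC cK.
  by apply: eq_msmooth_on (msmooth_on_cst 0 oK) => // p /phi0 ->.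
exists K, (to_cinfty sphi); split => //=.
have cont := to_coord_continuous cx.
have n1 : nbhs x (dom c) by exact: open_nbhs_nbhs.
have e20 : 0 < e / 2 by rewrite divr_gt0.
have n2 : nbhs x [set p | forall i, `|to_coord c p ord0 i - a ord0 i| <= e / 2].
  have nx : nbhs x (to_coord c @^-1` ball a (e / 2)).
    by apply: cont; exact: nbhsx_ballx.
  apply: filterS nx => p [_ ap] i.
  by have := ap ord0 i; rewrite /ball /= distrC => /ltW.
have := [elaborate filterI n1 n2]; rewrite nbhsE /= => -[V [oV Vx] VP].
exists V => // p /VP[cp pe].
rewrite /phi mem_set //; apply: big1 => i _; exact: plateau1.
Qed.

End SmoothLocality.

(** * Global sections expressed in cut-off local frames *)

Section LocalFrames.
Variables (R : realType) (n r : nat) (M : manifold R n) (E : vector_bundle M r).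
Variables (t : trivialization E r) (K : set M) (phi : cinfty M).
Hypotheses (tE : trivializations t) (cK : closed K) (Kt : K `<=` base t).
Hypothesis phi0 : forall q, ~ K q -> phi q = 0.

Lemma cutoff_frame_smooth (w : 'rV[R]_r) :
  smooth_section_on setT (fun q => phi q *: of_fibre_coord t q w).
Proof.
move=> u uE i; rewrite setTI.
have -> : (fun q => fibre_coord u q (phi q *: of_fibre_coord t q w) ord0 i)
    = phi \* (fun q => fibre_coord u q (of_fibre_coord t q w) ord0 i).
  by apply/funext => q /=; rewrite linearZ mxE.
apply: (msmooth_on_mul_support (base_open t) (base_open u) cK Kt phi0).
  by apply: msmooth_on_sub (cinftyP phi) => //; exact: base_open.
by rewrite setIC; exact: transition_smooth.
Qed.

Definition cutoff_frame i : gsection E :=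
  GSection (cutoff_frame_smooth (delta_mx ord0 i)).

Lemma cutoff_coord_smooth (s : gsection E) i :
  msmooth_on setT (phi \* (fun q => fibre_coord t q (s q) ord0 i)).
Proof.
apply: (msmooth_on_mul_support (base_open t) openT cK Kt phi0).
  exact: cinftyP.
exact: gsection_smooth.
Qed.

Definition cutoff_coord (s : gsection E) i : cinfty M :=
  to_cinfty (cutoff_coord_smooth s i).

Lemma gsection_sum (I : finType) (F : I -> gsection E) q :
  (\sum_i F i : gsection E) q = \sum_i F i q.
Proof. exact: (big_morph (fun s : gsection E => s q)). Qed.

(** One factor [phi] makes the coordinates global functions, the other makes the frame global
    sections. *)
Lemma cutoff_frame_sum (s : gsection E) :
  (phi * phi) *: s = \sum_i cutoff_coord s i *: cutoff_frame i.
Proof.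
apply: gsection_eq => q; rewrite gsection_sum.
have -> : ((phi * phi) *: s) q = (phi q * phi q) *: s q by [].
have -> : \sum_i (cutoff_coord s i *: cutoff_frame i) q
    = \sum_i (phi q * fibre_coord t q (s q) ord0 i)
        *: (phi q *: of_fibre_coord t q (delta_mx ord0 i)) by [].
have [/Kt tq|/phi0 ->] := pselect (K q); last first.
  by rewrite mul0r scale0r big1 // => i _; rewrite mul0r scale0r.
apply: (can_inj (fibre_coordK tq)).
rewrite linear_sum /= linearZ /= [in LHS](row_sum_delta (fibre_coord t q (s q))).
rewrite scaler_sumr; apply: eq_bigr => i _.
rewrite !linearZ /= of_fibre_coordK // !scalerA; congr (_ *: _); ring.
Qed.

End LocalFrames.

(** * Difference bounds for smooth functions along coordinate lines *)

Section CoordinateLines.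
Variables (R : realType).

(** The interval is described by its midpoint, which keeps the hypothesis symmetric in [a] and
    [b]. *)
Lemma mean_value_bound (f f' : R -> R) (a b B : R) :
  (forall y, `|y - (a + b) / 2| <= `|a - b| / 2 ->
    is_derive y 1 f (f' y) /\ `|f' y| <= B) ->
  `|f a - f b| <= B * `|a - b|.
Proof.
wlog ab : a b / b <= a.
  move=> wl; case: (leP b a) => [|/ltW] ab fab; first exact: wl.
  rewrite distrC [X in B * X]distrC; apply: wl => // y.
  by rewrite distrC (addrC b) distrC (distrC b); exact: fab.
move=> fab; have {}fab y : y \in `[b, a]%R -> is_derive y 1 f (f' y) /\ `|f' y| <= B.
  rewrite in_itv /= => /andP[by_ ya]; apply: fab.
  by rewrite [`|a - b|]ger0_norm ?subr_ge0 // ler_norml; lra.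
have cf : {within `[b, a], continuous f}.
  apply: derivable_within_continuous => y /fab[df _].
  by have [] := df.
have [|y yab ->] := MVT_segment (df := f') ab _ cf.
  by move=> y /subset_itv_oo_cc /fab[].
by rewrite normrM ler_wpM2r //; have [] := fab y yab.
Qed.

(** The second difference is the increment of [z |-> g (y + z) + g (y - z)] from 0 to [h]. The
    derivative of this map is a first difference of [g1], bounded in turn through [g2]. *)
Lemma tame_C2 (g g1 g2 : R -> R) (q e : R) : 0 < e ->
  (forall y, `|y - q| < e -> is_derive y 1 g (g1 y)) ->
  (forall y, `|y - q| < e -> is_derive y 1 g1 (g2 y)) ->
  {for q, continuous g1} -> {for q, continuous g2} ->
  exists C r : R, 0 < r /\ tame g C q r.
Proof.
move=> e0 dg dg1 c1 c2.
pose B : R := `|g1 q| + `|g2 q| + 1.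
have [d /= d0 gB] : exists2 d : R, 0 < d & forall y, `|y - q| < d -> `|g1 y| <= B /\ `|g2 y| <= B.
  have nb (g' : R -> R) : {for q, continuous g'} -> \forall y \near q, `|g' y| <= `|g' q| + 1.
    move=> /cvgrPdist_le /(_ 1 ltr01); apply: filterS => y.
    rewrite distrC => yq; have := ler_normD (g' y - g' q) (g' q).
    by rewrite subrK => /le_trans; apply; rewrite addrC lerD2l.
  have [d /= d0 dP] := [elaborate filterI (nb _ c1) (nb _ c2)].
  exists d => // y yq; have [] := dP y; first by rewrite /= distrC.
  move=> /le_trans h1 /le_trans h2; split; [apply: h1|apply: h2]; rewrite /B.
    by rewrite lerD2r lerDl.
  by rewrite lerD2r lerDr.
pose d' : R := Num.min e d.
exists (2 * B), d'; rewrite lt_min e0 d0; split=> // y h yh1 yh2.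
have gB' z : `|z - q| < d' -> [/\ is_derive z 1 g (g1 z), is_derive z 1 g1 (g2 z),
    `|g1 z| <= B & `|g2 z| <= B].
  rewrite lt_min => /andP[ze zd]; have [z1 z2] := gB z zd.
  by split=> //; [exact: dg|exact: dg1].
have shift_near z : `|z| <= `|h| -> `|y + z - q| < d' /\ `|y - z - q| < d'.
  move=> zh; have : `|y - q| + `|h| < d'.
    by move: yh1 yh2; case: (ger0P h) => _; case: (ger0P (y - q)) => _;
       rewrite !ltr_norml; lra.
  move=> yqh; split; rewrite addrAC (le_lt_trans (ler_normD _ _)) ?normrN //.
    by rewrite (le_lt_trans _ yqh) // lerD2l.
  by rewrite (le_lt_trans _ yqh) // lerD2l.
have mv (f f' : R -> R) : (forall z, `|z - q| < d' -> is_derive z 1 f (f' z) /\ `|f' z| <= B) ->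
    forall z, `|z| <= `|h| -> `|f (y + z) - f (y - z)| <= 2 * B * `|z|.
  move=> ff' z zh; have -> : 2 * B * `|z| = B * `|y + z - (y - z)|.
    have -> : y + z - (y - z) = 2 * z by ring.
    by rewrite normrM [`|2|]gtr0_norm //; ring.
  apply: mean_value_bound => w; rewrite (_ : (y + z + (y - z)) / 2 = y); last by field.
  rewrite (_ : y + z - (y - z) = z * 2); last by ring.
  rewrite normrM [`|2|]gtr0_norm // mulfK // => wz; apply: ff'.
  by have [+ _] := shift_near (w - y) (le_trans wz zh); rewrite [y + _]addrC subrK.
split; first by apply: (mv g g1) => // z /gB'[].
pose H (z : R) : R := g (y + z) + g (y - z).
have dH (z : R) : `|z| <= `|h| -> is_derive z 1 H (g1 (y + z) - g1 (y - z)).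
  move=> /shift_near[/gB'[d1 _ _ _] /gB'[d2 _ _ _]].
  have a1 : is_derive z 1 (fun z => y + z) 1.
    have := is_deriveD (is_derive_cst y z 1) (is_derive_id z 1).
    by rewrite add0r.
  have a2 : is_derive z 1 (fun z => y - z) (-1).
    have := is_deriveB (is_derive_cst y z 1) (is_derive_id z 1).
    by rewrite sub0r.
  have b1 := @is_derive1_comp R g (fun z => y + z) z _ _ d1 a1.
  have b2 := @is_derive1_comp R g (fun z => y - z) z _ _ d2 a2.
  by apply: trigger_derive (is_deriveD b1 b2) _; rewrite mulr1 mulrN1.
have -> : g (y + h) - g y *+ 2 + g (y - h) = H h - H 0.
  by rewrite /H subr0 addr0; ring.
have -> : 2 * B * h ^+ 2 = 2 * B * `|h| * `|h - 0|.
  by rewrite subr0 -[h ^+ 2]real_normK ?num_real // expr2 mulrA.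
apply: (mean_value_bound (f' := fun z => g1 (y + z) - g1 (y - z))) => z.
rewrite addr0 subr0 => zh; have {}zh : `|z| <= `|h|.
  have := ler_normD (z - h / 2) (h / 2); rewrite subrK normrM [`|2^-1|]gtr0_norm ?invr_gt0 //.
  by lra.
split; first exact: dH.
have B0 : 0 <= B by rewrite !addr_ge0.
apply: le_trans (mv g1 g2 _ z zh) _; first by move=> w /gB'[].
by rewrite ler_wpM2l // mulr_ge0.
Qed.

Lemma is_derive_line (n : nat) (F : 'rV[R]_n -> R) (a v : 'rV[R]_n) (tau : R) :
  differentiable F (a + tau *: v) ->
  is_derive tau 1 (fun tau => F (a + tau *: v)) ('D_v F (a + tau *: v)).
Proof.
move=> dF; have dv : derivable F (a + tau *: v) v by exact: diff_derivable.
have E : (fun h : R => h^-1 *: (F (a + (h *: 1 + tau) *: v) - F (a + tau *: v)))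
    = (fun h => h^-1 *: (F (h *: v + (a + tau *: v)) - F (a + tau *: v))).
  apply/funext => h; congr (_ *: (F _ - _)).
  by rewrite [h *: 1]mulr1 scalerDl addrCA.
by apply: DeriveDef; rewrite /derivable /derive /= E.
Qed.

Lemma smooth_on_line_tame (n : nat) (W : set 'rV[R]_n) (F : 'rV[R]_n -> R)
  (a v : 'rV[R]_n) (e : R) : smooth_on W F ->
  (forall tau, `|tau| < e -> W (a + tau *: v)) ->
  forall q, `|q| < e -> exists C r : R, 0 < r /\ tame (fun tau => F (a + tau *: v)) C q r.
Proof.
move=> sF We q qe; have [d0 /(_ v)[d1 /(_ v)[d2 _]]] := sF 3%N.
have W' y : `|y - q| < e - `|q| -> W (a + y *: v).
  move=> yq; apply: We; have := ler_normD (y - q) q.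
  by rewrite subrK => /le_lt_trans; apply; rewrite -ltrBrDr.
have cont (G : 'rV[R]_n -> R) : (forall y, W y -> differentiable G y) ->
    {for q, continuous (fun tau : R => G (a + tau *: v))}.
  move=> dG; apply/differentiable_continuous/derivable1_diffP.
  by have [] := is_derive_line (dG _ (We q qe)).
apply: (@tame_C2 _ (fun tau => 'D_v F (a + tau *: v))
    (fun tau => 'D_v ('D_v F) (a + tau *: v)) q (e - `|q|)).
- by rewrite subr_gt0.
- by move=> y /W' Wy; apply: is_derive_line; exact: d0.
- by move=> y /W' Wy; apply: is_derive_line; exact: d1.
- exact: cont d1.
- exact: cont d2.
Qed.

End CoordinateLines.

(** * Additivity of the bracket in its second argument in positive dimension *)

Section BracketAdditivity.
Variables (R : realType) (n r : nat) (M : manifold R n) (A : lie_algebroid M r).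
Implicit Types (a b d : gsection A) (f g : cinfty M).

Lemma bracketDl a b d : bracket (a + b) d = bracket a d + bracket b d.
Proof.
have one s : cinfty_cst M 1 *: s = s :> gsection A.
  by apply: gsection_eq => q; exact: scale1r.
by have := bracket_linear 1 a b d; rewrite !one.
Qed.

Lemma tangent_cst p (v : tangent p) (c : R) : v (cinfty_cst M c) = 0.
Proof.
have v0 : v 0 = 0.
  have := tangent_linear v 1 0 0; rewrite scaler0 addr0 mul1r => /eqP.
  by rewrite -subr_eq0 opprD addrA subrr sub0r oppr_eq0 => /eqP.
have v1 : v 1 = 0.
  have := tangentM v 1 1; rewrite mulr1 => /eqP.
  have -> : (1 : cinfty M) p = 1 by [].
  by rewrite mulr1 mul1r -subr_eq0 opprD addrA subrr sub0r oppr_eq0 => /eqP.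
have -> : cinfty_cst M c = c *: (1 : cinfty M) + 0.
  by apply: cinfty_eq => q; rewrite addr0; exact/esym/mulr1.
by rewrite tangent_linear v1 v0 mulr0 addr0.
Qed.

Lemma vf_app_cst (X : vector_field M) (c : R) : vf_app X (cinfty_cst M c) = 0.
Proof. by apply: cinfty_eq => p; exact: tangent_cst. Qed.

Section AlongCoordinate.
Variables (x : M) (a b d : gsection A) (y1 : cinfty M).

Lemma pull_smooth (s : R -> R) : smoothR s -> msmooth_on setT (s \o y1).
Proof. by move=> ss; apply: msmooth_on_comp => //; [exact: openT|exact: cinftyP]. Qed.

(** The default 0 makes this total, since the homogeneous maps above take arbitrary functions as
    arguments. *)
Definition pull (s : R -> R) : cinfty M :=
  if pselect (smoothR s) is left ss then to_cinfty (pull_smooth ss) else 0.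

Lemma pullE s q : smoothR s -> pull s q = s (y1 q).
Proof. by rewrite /pull; case: pselect. Qed.

Lemma pullM s t : smoothR s -> smoothR t -> pull (s \* t) = pull s * pull t.
Proof.
move=> ss st; apply: cinfty_eq => q.
rewrite pullE; last exact: smoothR_mul.
by have -> : (pull s * pull t) q = pull s q * pull t q by []; rewrite !pullE.
Qed.

Lemma pull_cst c : pull (cst c) = cinfty_cst M c.
Proof. by apply: cinfty_eq => q; rewrite pullE //; exact: smoothR_cst. Qed.

(** Subtracting the derivative terms of the Leibniz rule leaves an expression homogeneous under
    multiplication of both [s] and [t] by the same function. *)
Definition tensorial_part (s t : R -> R) : gsection A :=
  bracket a (pull s *: b + pull t *: d)
  - (vf_app (anchor_vf a) (pull s) *: b + vf_app (anchor_vf a) (pull t) *: d).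

(** The Leibniz rule is applied to [h] times the whole sum, so the bracket of a sum is never
    split. *)
Lemma tensorial_partM h s t : smoothR h -> smoothR s -> smoothR t ->
  tensorial_part (h \* s) (h \* t) = pull h *: tensorial_part s t.
Proof.
move=> sh ss st; rewrite /tensorial_part !pullM // -!scalerA -scalerDr.
rewrite bracket_leibniz !vf_appM !scalerDl -!scalerA scalerBr !scalerDr.
set u1 := pull h *: bracket _ _.
set u2 := vf_app _ (pull h) *: _; set u3 := vf_app _ (pull h) *: _.
set u4 := pull h *: _; set u5 := pull h *: _.
by rewrite [u2 + u4 + _]addrACA opprD addrA addrK.
Qed.

End AlongCoordinate.

Lemma bracketDr a b d : (0 < n)%N -> bracket a (b + d) = bracket a b + bracket a d.
Proof.
move=> n0; apply: gsection_eq => x; pose i0 := Ordinal n0.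
have [c ac cx] := atlas_cover x; have [t tA tx] := trivializations_cover A x.
have oU : open (dom c `&` base t) by apply: openI; [exact: dom_open|exact: base_open].
have [K [phi [cK KU phi0 [V [oV Vx] phi1]]]] := smooth_bump oU (conj cx tx).
pose a0 := to_coord c x; pose v : 'rV[R]_n := delta_mx ord0 i0.
have VU : V `<=` dom c `&` base t.
  move=> q Vq; apply: KU; apply: contrapT => /phi0.
  by rewrite phi1 // => /eqP; rewrite oner_eq0.
have sy1 : msmooth_on setT (phi \* (fun q => to_coord c q ord0 i0 - a0 ord0 i0)).
  have od := dom_open c.
  have Kc : K `<=` dom c by move=> q /KU[].
  apply: (msmooth_on_mul_support od openT _ Kc phi0); [exact: cK|exact: cinftyP|].
  rewrite setTI.
  exact: msmooth_onD od (msmooth_on_coord i0 ac) (msmooth_on_cst (- a0 ord0 i0) od).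
pose y1 := to_cinfty sy1.
have Wa : (cod c `&` of_coord c @^-1` V) a0.
  by split; [exact: to_cod|rewrite /= to_coordK].
have [e e0 eW] := open_box (coord_open oV) Wa.
have lineW tau : `|tau| < e -> (cod c `&` of_coord c @^-1` V) (a0 + tau *: v).
  move=> te; apply: eW => i; rewrite !mxE eqxx addrAC subrr add0r /=.
  by case: eqP => _; rewrite ?mulr1 ?mulr0 ?normr0 ltW.
pose gam tau := of_coord c (a0 + tau *: v).
(* On the coordinate line through [x] the cut-off coordinate [y1] is the parameter, so [pull y1 h]
   restricts to [h] there. *)
have y1gam tau : `|tau| < e -> y1 (gam tau) = tau.
  move=> /lineW[ct Vt]; rewrite /= phi1 // of_coordK // !mxE !eqxx mul1r mulr1.
  by rewrite addrAC subrr add0r.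
have gam0 : gam 0 = x by rewrite /gam scale0r addr0 to_coordK.
suff coordE i : fibre_coord t x (bracket a (b + d) x) ord0 i
    = fibre_coord t x ((bracket a b + bracket a d : gsection A) x) ord0 i.
  by apply: (can_inj (fibre_coordK tx)); apply/rowP => i; exact: coordE.
pose F s u q := fibre_coord t q (tensorial_part a b d y1 s u q) ord0 i.
have F_homogeneous h s u : smoothR h -> smoothR s -> smoothR u ->
    forall tau, `|tau| < e -> F (h \* s) (h \* u) (gam tau) = h tau * F s u (gam tau).
  move=> sh ss su tau te; rewrite /F tensorial_partM //.
  have -> : h tau = pull y1 h (gam tau) by rewrite pullE // y1gam.
  have -> : (pull y1 h *: tensorial_part a b d y1 s u) (gam tau)
    = pull y1 h (gam tau) *: tensorial_part a b d y1 s u (gam tau) by [].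
  by rewrite linearZ mxE.
have F_tame s u : smoothR s -> smoothR u -> forall q, `|q| < e ->
    exists C r : R, 0 < r /\ tame (fun tau => F s u (gam tau)) C q r.
  move=> ss su q qe.
  have sF := gsection_smooth (tensorial_part a b d y1 s u) tA i ac.
  apply: (smooth_on_line_tame sF _ qe) => tau /lineW[ct Vt].
  by split=> //; split=> //; have [] := VU _ Vt.
(* At constant [s] and [t] the derivative terms vanish, and the identity becomes the claim at
   [x = gam 0]. *)
have := homogeneous_additive F_homogeneous F_tame e0.
rewrite gam0 /F /tensorial_part !pull_cst !vf_app_cst !scale0r addr0 !subr0.
have cst1 (s : gsection A) : cinfty_cst M 1 *: s = s.
  by apply: gsection_eq => q; exact: scale1r.
have cst0 (s : gsection A) : cinfty_cst M 0 *: s = 0.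
  by apply: gsection_eq => q; exact: scale0r.
rewrite !cst1 !cst0 add0r addr0 => ->.
have -> : (bracket a b + bracket a d : gsection A) x = bracket a b x + bracket a d x by [].
by rewrite linearD mxE addrC.
Qed.

End BracketAdditivity.

(** * Base of dimension zero *)

Section DimensionZero.
Variables (R : realType) (M : manifold R 0).

Lemma point_open (x : M) : open [set x].
Proof.
have [c _ cx] := atlas_cover x; suff -> : [set x] = dom c by exact: dom_open.
apply/seteqP; split=> [_ -> //|q cq] /=.
by rewrite -(to_coordK cx) -(to_coordK cq) (thinmx0 (to_coord c q)) (thinmx0 (to_coord c x)).
Qed.

Lemma point_bump (x : M) :
  exists2 phi : cinfty M, phi x = 1 & forall q, q <> x -> phi q = 0.
Proof.
have [K [phi [_ Kx phi0 [V [_ Vx] phi1]]]] := smooth_bump (point_open x) erefl.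
by exists phi => [|q qx]; [exact: phi1|apply: phi0 => /Kx].
Qed.

(** With [phi] the bump at [x], the product of [phi] and [f - f x] is identically 0, while [v] maps
    it to [v f]. *)
Lemma tangent_dim0 (x : M) (v : tangent x) : v = 0.
Proof.
have [phi phix phi0] := point_bump x.
apply: val_inj; apply/funext => f; change (v f = 0).
have : phi * (1 *: f + cinfty_cst M (- f x)) = cinfty_cst M 0.
  apply: cinfty_eq => q; change (phi q * (1 * f q - f x) = 0).
  have [->|/phi0 ->] := pselect (q = x); last by rewrite mul0r.
  by rewrite mul1r subrr mulr0.
move=> /(congr1 v); rewrite tangent_cst tangentM tangent_linear tangent_cst phix.
have -> : (1 *: f + cinfty_cst M (- f x)) x = 1 * f x - f x by [].
by rewrite !mul1r subrr mulr0 add0r addr0.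
Qed.

End DimensionZero.

(** * Brackets with a section whose anchor vanishes at the point *)

Section PointwiseBracket.
Variables (R : realType) (n r : nat) (M : manifold R n) (A : lie_algebroid M r).
Variable x : M.
Implicit Types (a b d : gsection A) (f : cinfty M).

Lemma bracket0r a : bracket a 0 = 0.
Proof. by have := bracket_leibniz a 0 0; rewrite scaler0 scale0r scaler0 addr0. Qed.

Lemma isotropy_leibniz a f b : anchor A x (a x) = 0 ->
  bracket a (f *: b) x = f x *: bracket a b x.
Proof.
move=> ax; rewrite bracket_leibniz.
have -> : (f *: bracket a b + vf_app (anchor_vf a) f *: b) x
  = f x *: bracket a b x + anchor A x (a x) f *: b x by [].
by rewrite ax; have -> : (0 : tangent x) f = 0 by []; rewrite scale0r addr0.
Qed.

(** Near [x] the section [d] is a combination of frame sections with coefficients vanishing at [x];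
    additivity and the Leibniz rule take these coefficients out of the bracket. *)
Lemma bracket_vanishing a d : (0 < n)%N -> anchor A x (a x) = 0 -> d x = 0 ->
  bracket a d x = 0.
Proof.
move=> n0 ax dx; have [t tA tx] := trivializations_cover A x.
have [K [phi [cK Kt phi0 [V [_ Vx] phi1]]]] := smooth_bump (base_open t) tx.
have phix := phi1 x Vx.
have := isotropy_leibniz (phi * phi) d ax.
have -> : (phi * phi : cinfty M) x = phi x * phi x by [].
rewrite phix mulr1 scale1r => <-.
rewrite (cutoff_frame_sum tA cK Kt phi0 d).
rewrite (big_morph (bracket a) (fun s u => bracketDr a s u n0) (bracket0r a)).
rewrite gsection_sum big1 // => i _; rewrite isotropy_leibniz //.
have -> : cutoff_coord tA cK Kt phi0 d i x = phi x * fibre_coord t x (d x) ord0 i by [].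
by rewrite dx linear0 mxE mulr0 scale0r.
Qed.

End PointwiseBracket.

(** * The bracket on the isotropy at a point *)

Section IsotropyAlgebra.
Variables (R : realType) (n r : nat) (M : manifold R n) (A : lie_algebroid M r).
Variable x : M.
Implicit Types (a b d : gsection A) (f : cinfty M).

Lemma bracket_pointwise a b d : anchor A x (a x) = 0 -> b x = d x ->
  bracket a b x = bracket a d x.
Proof.
move=> ax bd; have [n0|] := ltnP 0 n.
  rewrite -[b](subrK d) addrC bracketDr //.
  have -> : (bracket a d + bracket a (b - d) : gsection A) x
    = bracket a d x + bracket a (b - d) x by [].
  rewrite (bracket_vanishing (d := b - d) n0 ax) ?addr0 //.
  by change (b x - d x = 0); rewrite bd subrr.
(* In dimension 0 the bump at the point makes [phi *: b] and [phi *: d] equal as sections, so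
   additivity is not involved. *)
rewrite leqn0 => /eqP n0; move: n0 M A x a b d ax bd => -> M' A' x' a b d ax bd.
have [phi phix phi0] := point_bump x'.
have E : phi *: b = phi *: d.
  apply: gsection_eq => q; change (phi q *: b q = phi q *: d q).
  have [->|/phi0 ->] := pselect (q = x'); first by rewrite bd.
  by rewrite !scale0r.
have := isotropy_leibniz phi d ax; rewrite -E isotropy_leibniz // phix !scale1r.
exact.
Qed.

(** Put [w = [a, b]]. By the Jacobi identity [[w, f w](x)] is a difference of iterated brackets with
    [a] and [b], hence equals [f(x) [w, w](x) = 0]. By the Leibniz rule it also equals [rho(w)(f) w]
    at [x]; so either [w] or its anchor vanishes there. *)
Lemma anchor_bracket_isotropy a b : anchor A x (a x) = 0 -> anchor A x (b x) = 0 ->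
  anchor A x (bracket a b x) = 0.
Proof.
have [n0|] := ltnP 0 n; last first.
  rewrite leqn0 => /eqP n0 _ _.
  by move: n0 M A x a b => -> M' A' x' a b; exact: tangent_dim0.
move=> ax bx; pose w := bracket a b; rewrite -/w.
have bracketC (s u : gsection A) : bracket s u = - bracket u s.
  have := bracket_alternating (s + u).
  rewrite bracketDl !bracketDr // !bracket_alternating add0r addr0.
  by move/eqP; rewrite addr_eq0 => /eqP.
have bracketNr (s u : gsection A) : bracket s (- u) = - bracket s u.
  by apply/eqP; rewrite -addr_eq0 -bracketDr // addNr bracket0r.
have jacobi d : bracket a (bracket b d) x - bracket b (bracket a d) x = bracket w d x.
  have := bracket_jacobi a b d; rewrite (bracketC d a) bracketNr (bracketC d).
  move=> /(congr1 (fun s : gsection A => s x)).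
  change (bracket a (bracket b d) x - bracket b (bracket a d) x - bracket w d x = 0
    -> bracket a (bracket b d) x - bracket b (bracket a d) x = bracket w d x).
  by move/eqP; rewrite subr_eq0 => /eqP.
have iterated (s u : gsection A) f : anchor A x (s x) = 0 -> anchor A x (u x) = 0 ->
    bracket s (bracket u (f *: w)) x = f x *: bracket s (bracket u w) x.
  move=> sx ux; rewrite -isotropy_leibniz //; apply: bracket_pointwise => //.
  exact: isotropy_leibniz.
have wf f : anchor A x (w x) f *: w x = 0.
  have ww : bracket w (f *: w) = vf_app (anchor_vf w) f *: w.
    by rewrite bracket_leibniz bracket_alternating scaler0 add0r.
  have := jacobi (f *: w); rewrite !iterated // -scalerBr jacobi ww bracket_alternating.
  by move/esym; have -> : (0 : gsection A) x = 0 by []; rewrite scaler0.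
have [wx|wx] := eqVneq (w x) 0; first by rewrite wx linear0.
apply: val_inj; apply/funext => f; have /eqP := wf f.
by rewrite scaler_eq0 (negbTE wx) orbF => /eqP.
Qed.

End IsotropyAlgebra.

(** * The splitting of the isotropy algebra by the symbol *)

Theorem corollary5p8 (R : realType) (n r m : nat) (M : manifold R n)
    (A : lie_algebroid M r) (k : ideal_bundle A m) (hk : partially_split k)
    (x : M) (C : im_connection k) :
  isotropy_direct_sum_of_ideals
    (isotropy A x `&` [set u | symbol C x u = 0]) (k x).
Proof.
have kx0 : k x 0.
  have [U [e [_ Ux _ /(_ x Ux)[-> _]]]] := ideal_frame k x.
  by exists (fun=> 0) => //; rewrite big1 // => i _; rewrite scale0r.
(* The IM equation for the symbol at [x], where the term [L(a)(rho(b))] drops out. *)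
have symbolE (a b : gsection A) : anchor A x (a x) = 0 -> anchor A x (b x) = 0 ->
    symbol C x (bracket a b x) = bracket a (GSection (symbol_smooth C b)) x.
  move=> ax bx; have := symbol_bracket C a b.
  move=> /(congr1 (fun s : gsection A => s x)).
  change (symbol C x (bracket a b x) = bracket a (GSection (symbol_smooth C b)) x
    - im_op C a x (anchor A x (b x)) -> symbol C x (bracket a b x)
    = bracket a (GSection (symbol_smooth C b)) x).
  by rewrite bx linear0 subr0.
split.
- split=> [|u []//|u v ux [vx lv]].
  + split=> [|c u v /set_mem[ux lu] /set_mem[vx lv]]; apply/mem_set; split=> /=.
    * by rewrite /isotropy /= linear0.
    * by rewrite linear0.
    * by rewrite /isotropy /= linearP ux vx scaler0 addr0.
    * by rewrite linearP lu lv scaler0 addr0.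
  (* The case without witnesses is the default value 0, which lies in the summand. *)
  + rewrite /isotropy_bracket; case: xgetP => [w _ [a [b [au bv <-]]]|_]; last first.
      by split; [rewrite /isotropy /= linear0|rewrite /= linear0].
    have ax : anchor A x (a x) = 0 by rewrite au.
    have bx : anchor A x (b x) = 0 by rewrite bv.
    split; first exact: anchor_bracket_isotropy.
    (* The section [l(b)] vanishes at [x], so the zero section may replace it in the bracket. *)
    rewrite /= symbolE // (bracket_pointwise (d := 0)) ?bracket0r //.
    by rewrite /= bv lv.
- split=> [|u|u v ux kv].
  + split=> [|c u v /set_mem + /set_mem]; first exact/mem_set.
    have [U [e [_ Ux _ /(_ x Ux)[-> _]]]] := ideal_frame k x.
    move=> [c1 _ <-] [c2 _ <-]; apply/mem_set; exists (fun i => c * c1 i + c2 i) => //.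
    rewrite scaler_sumr -big_split; apply: eq_bigr => i _ /=.
    by rewrite scalerDl scalerA.
  + exact: ideal_anchor.
  + rewrite /isotropy_bracket; case: xgetP => [w _ [a [b [au bv <-]]]|_] //.
    have ax : anchor A x (a x) = 0 by rewrite au.
    (* The symbol fixes [v], so [b] may be replaced by [l(b)], which takes values in [k] everywhere,
       as [ideal_bracket] requires. *)
    rewrite (bracket_pointwise (d := GSection (symbol_smooth C b))) //.
      by apply: ideal_bracket => p; exact: symbol_ideal.
    by rewrite /= bv symbol_id.
- apply/seteqP; split=> [u ux|_ [u [ux _]] [v kv] <-]; last first.
    by rewrite /isotropy /= linearD ux (ideal_anchor kv) addr0.
  (* The symbol is a projection onto [k], so [u - l(u)] lies in its kernel. *)
  exists (u - symbol C x u); last by exists (symbol C x u); [exact: symbol_ideal|rewrite subrK].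
  split; last by rewrite /= linearB (symbol_id C (symbol_ideal C u)) subrr.
  by rewrite /isotropy /= linearB ux (ideal_anchor (symbol_ideal C u)) subr0.
- apply/seteqP; split=> [u [[_ lu] ku]|_ ->] /=; first by rewrite -(symbol_id C ku).
  by split=> //; split; rewrite /isotropy /= linear0.
Qed.
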